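(* Let $k$ be a positive integer and let $G$ be a $3$-connected non-bipartite graph. If $\delta(G)\ge k+1$, then $G$ contains $k$ cycles which have consecutive lengths or satisfy the length condition.
   Context: All graphs are finite and simple; $\delta(G)$ is the minimum degree. A sequence of cycles $H_1,\dots,H_k$ has consecutive lengths if $|E(H_1)|\ge 2$ and $|E(H_{i+1})|-|E(H_i)|=1$ for $1\le i\le k-1$; it satisfies the length condition if $|E(H_1)|\ge 2$ and $|E(H_{i+1})|-|E(H_i)|=2$ for $1\le i\le k-1$. *)

(* Defs.v *)
From mathcomp Require Import all_boot.

Set Implicit Arguments.
Unset Strict Implicit.
Unset Printing Implicit Defensive.

Record sgraph := SGraph {
  vertex :> finType;
  adj : rel vertex;
  adj_sym : symmetric adj;
  adj_irrefl : irreflexive adj }.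

Section Graph.
Variable G : sgraph.
Implicit Types (x y : G) (S A : {set G}) (c : seq G) (H : seq (seq G)).

Definition degree x := #|[set y | adj x y]|.

(* Every degree is less than #|G|, so the default value #|G| of the minimum
   is only reached when G has no vertex. *)
Definition min_degree := \big[minn/#|G|]_(x : G) degree x.

Definition bipartite :=
  exists A, forall x y, adj x y -> (x \in A) != (y \in A).

(* The adjacency relation of G - S. *)
Definition adj_minus S : rel G :=
  [rel x y | [&& adj x y, x \notin S & y \notin S]].

Definition connected_minus S :=
  forall x y, x \notin S -> y \notin S -> connect (adj_minus S) x y.

Definition k_connected n :=
  n < #|G| /\ forall S, #|S| < n -> connected_minus S.

(* A cycle of G is given by the sequence of its vertices, listed from any
   starting point in either direction; the bound on the size excludes single
   vertices and edges traversed back and forth. *)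
Definition is_cycle c := [&& 2 < size c, cycle (@adj G) c & uniq c].

Definition cycle_edges c : {set {set G}} := [set [set x; next c x] | x in c].

(* The sequence H starts with a cycle with at least two edges, and each cycle
   in it has exactly d edges more than the previous one. *)
Definition lengths_step d H :=
  2 <= #|cycle_edges (head [::] H)| /\
  sorted (fun c1 c2 => #|cycle_edges c2| == #|cycle_edges c1| + d) H.

Definition consecutive_lengths H := lengths_step 1 H.

Definition length_condition H := lengths_step 2 H.

Lemma card_cycle_edges c : is_cycle c -> #|cycle_edges c| = size c.
Proof.
case/and3P=> c_gt2 _ Uc; rewrite card_in_imset; first exact/card_uniqP.
move=> x y xc yc eq_xy; apply/eqP/negPn/negP=> neq_xy.
have: y \in [set x; next c x] by rewrite eq_xy set21.
have: x \in [set y; next c y] by rewrite -eq_xy set21.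
rewrite !inE [y == x]eq_sym (negPf neq_xy) /= => /eqP xE /eqP yE.
move: xE; rewrite yE => xE; have [i s rotE] := rot_to xc.
move: xE; rewrite -!(next_rot i Uc) rotE.
move: Uc c_gt2; rewrite -(rot_uniq i) -(size_rot i) rotE.
case: s {rotE} => [|u [|v s]] //= /and3P[].
rewrite !inE !negb_or => /and3P[xu xv _] _ _ _.
by rewrite eqxx [u == x]eq_sym (negPf xu) eqxx => /eqP; rewrite (negPf xv).
Qed.

End Graph.

(* Main.v *)
Require Import Defs.
From mathcomp Require Import all_boot.
From mathcomp Require Import zify.

(** The theorem is deduced from a statement on rooted graphs (after Gao, Huo,
    Liu and Ma): if G + xy is 2-connected and every vertex other than x and y
    has degree at least k + 1, then there are k paths from x to y, of length at
    least 2, whose lengths form an arithmetic progression of difference 1 or 2.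
    Closing these paths by an edge xy of the 3-connected graph gives the cycles.

    The rooted statement is proved by induction on the number of vertices.  A
    2-separation hides a smaller rooted graph, so G + xy may be taken to be
    3-connected.  Choose a dense subgraph H through x avoiding y - a maximal
    clique; or x, two of its neighbours w1, w2 and a maximal clique in their
    common neighbourhood; or a complete bipartite graph - with an exit set U
    such that the paths in H from x to any vertex of U realise one and the same
    progression of s lengths.  By maximality, contracting U to a new root and
    deleting the rest of H lowers degrees by at most s - 1 in the component of
    y.  Induction gives k - s + 1 paths there, and adding a progression of s
    terms to one of k - s + 1 terms gives one of k terms.  If the contracted
    graph is not 2-connected, some piece D is attached to H only outside U, and
    the same contraction is performed inside D.  The remaining separations
    {x, p, c} are treated by concatenating k - 1 paths from x to p with two
    paths from p to y; this needs the case k = 2 with one exceptional vertex c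
    of small degree, whence the exceptional set X below. *)

Set Implicit Arguments.
Unset Strict Implicit.
Unset Printing Implicit Defensive.

(** The lengths inside H must be the same towards every exit, because a path found after the
    contraction may start from any vertex of U. The three kinds of H are chosen for the bound on the
    degree loss. A vertex outside a maximal clique misses one of its vertices. If x is in no
    triangle, a vertex that sees x sees neither w1 nor w2. If x has no diamond either, a vertex with
    two neighbours among the exits of the biclique has none in the class of x. The second obstacle
    is that the neighbours of y may all be in H, so that nothing is left to contract onto.
    Exchanging the roots helps unless the situation is rigid: x and y have the same neighbourhood,
    which is a clique; or w1 and w2 form a cut; or all neighbours of y are exits of the biclique,
    and one of them replaces y as a root. For k = 2 an exceptional vertex may be all that remains
    beside y. This case, as well as triangles and 4-cycles at a root, is settled by two explicit
    paths. *)

Definition progression (s : nat) (P : nat -> Prop) :=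
  exists a d, (d = 1 \/ d = 2) /\ forall i, i < s -> P (a + d * i).

Lemma progression0 P : progression 0 P.
Proof. by exists 0, 1; split; [left|]. Qed.

Lemma progression1 (P : nat -> Prop) n : P n -> progression 1 P.
Proof.
by move=> Pn; exists n, 1; split=> [|[|i] //]; [left | rewrite muln0 addn0].
Qed.

Lemma progression_imply s (P Q : nat -> Prop) :
  (forall n, P n -> Q n) -> progression s P -> progression s Q.
Proof. by move=> PQ [a [d [d12 Pad]]]; exists a, d; split=> // i /Pad/PQ. Qed.

(** With equal differences this is the usual sumset. With differences 1 and 2, the one-step
    progression fills the gaps of the other as soon as it has two terms; with a single term it only
    translates the other. *)
Lemma progression_add s t k (P Q R : nat -> Prop) :
    0 < s -> 0 < t -> k < s + t ->
    (forall m n, P m -> Q n -> R (m + n)) ->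
  progression s P -> progression t Q -> progression k R.
Proof.
move=> s_gt0 t_gt0 lt_k PQR [a [d [d12 Pad]]] [b [c [c12 Qbc]]].
have [eq_dc | neq_dc] := eqVneq d c.
  exists (a + b), d; split=> // i lt_ik.
  pose j := minn i s.-1.
  have -> : a + b + d * i = (a + d * j) + (b + c * (i - j)).
    by rewrite -eq_dc mulnBr; have := leq_mul2l d j i; rewrite geq_minl orbT;
      lia.
  by apply: PQR; [apply: Pad | apply: Qbc]; rewrite /j; lia.
have [dc | dc] : (d = 1 /\ c = 2) \/ (d = 2 /\ c = 1) by lia.
  case: dc => dE cE; subst d c.
  have [s1 | s_gt1] := leqP s 1.
    exists (a + b), 2; split=> [|i lt_ik]; first by right.
    have -> : a + b + 2 * i = (a + 1 * 0) + (b + 2 * i) by lia.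
    by apply: PQR; [apply: Pad | apply: Qbc]; lia.
  exists (a + b), 1; split=> [|i lt_ik]; first by left.
  (* As many steps of size 2 as possible: the rest [i - 2 * j] is at most 1 or, when these steps are
     exhausted, at most [s - t]. *)
  pose j := minn (i./2) t.-1.
  have -> : a + b + 1 * i = (a + 1 * (i - 2 * j)) + (b + 2 * j) by rewrite /j;
    lia.
  by apply: PQR; [apply: Pad | apply: Qbc]; rewrite /j; lia.
case: dc => dE cE; subst d c.
have [t1 | t_gt1] := leqP t 1.
  exists (a + b), 2; split=> [|i lt_ik]; first by right.
  have -> : a + b + 2 * i = (a + 2 * i) + (b + 1 * 0) by lia.
  by apply: PQR; [apply: Pad | apply: Qbc]; lia.
exists (a + b), 1; split=> [|i lt_ik]; first by left.
pose j := minn (i./2) s.-1.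
have -> : a + b + 1 * i = (a + 2 * j) + (b + 1 * (i - 2 * j)) by rewrite /j;
  lia.
by apply: PQR; [apply: Pad | apply: Qbc]; rewrite /j; lia.
Qed.

Lemma progression_shift s m (P Q : nat -> Prop) :
  (forall n, P n -> Q (n + m)) -> progression s P -> progression s Q.
Proof.
move=> PQ [a [d [d12 Pad]]]; exists (a + m), d; split=> // i lt_is.
by rewrite addnAC; apply: PQ; apply: Pad.
Qed.

(** * Paths and connectivity *)

Section Paths.
Variables (T : finType) (e : rel T).
Implicit Types (V W A C D : {set T}) (u v w x y : T) (p q : seq T).

Definition pathp W u v n p :=
  [&& path e u p, last u p == v, uniq (u :: p), all [in W] (u :: p)
    & size p == n].

(* The set W contains the path but may have other vertices. *)
Definition pathl W u v n := exists p, pathp W u v n p.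

Definition nb W v := [set w in W | e v w].

Definition bd W D := [set w in W :\: D | [exists v in D, e v w]].

Lemma in_nb W v w : (w \in nb W v) = (w \in W) && e v w.
Proof. by rewrite inE. Qed.

Lemma bdP W D w :
  reflect [/\ w \in W, w \notin D & exists2 v, v \in D & e v w] (w \in bd W D).
Proof.
rewrite inE in_setD; apply: (iffP idP) =>
  [/andP[/andP[wD wW] /exists_inP[v Dv evw]] | [-> ->]].
  by split=> //; exists v.
by case=> v Dv evw /=; apply/exists_inP; exists v.
Qed.

Lemma all_in_sub W A p : W \subset A -> all [in W] p -> all [in A] p.
Proof. by move/subsetP=> sWA; apply: sub_all => z; apply: sWA. Qed.

Lemma pathl_sub W A u v n : W \subset A -> pathl W u v n -> pathl A u v n.
Proof.
move=> sWA [p /and5P[ep lp Up Wp sp]]; exists p; apply/and5P; split=> //.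
exact: all_in_sub Wp.
Qed.

Lemma pathl_refl W u : u \in W -> pathl W u u 0.
Proof. by move=> uW; exists [::]; rewrite /pathp /= eqxx uW. Qed.

Lemma pathl_ends W u v n : pathl W u v n -> u \in W /\ v \in W.
Proof.
case=> p /and5P[_ /eqP<- _ /allP Wp _]; split; apply: Wp; rewrite ?mem_head //.
exact: mem_last.
Qed.

Lemma pathl_cat W A u v w m n :
    (forall z, z \in W -> z \in A -> z = v) ->
  pathl W u v m -> pathl A v w n -> pathl (W :|: A) u w (m + n).
Proof.
move=> WA [p /and5P[ep /eqP lp Up Wp /eqP sp]] [q /and5P[eq /eqP lq Uq Aq /eqP
  sq]].
exists (p ++ q); rewrite /pathp cat_path lp ep eq last_cat lp lq eqxx size_cat.
rewrite sp sq eqxx -cat_cons cat_uniq Up all_cat !andbT /=; apply/and3P; split.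
- apply/andP; split; last by case/andP: Uq.
  apply/hasPn=> z qz; apply/negP=> pz; have zv: z = v.
    by apply: WA; [apply: (allP Wp) | apply: (allP Aq); rewrite inE qz orbT].
  by case/andP: Uq; rewrite -zv qz.
- exact: (all_in_sub (subsetUl W A) Wp).
by have /andP[] := all_in_sub (subsetUr W A) Aq.
Qed.

Lemma pathl_cons W u v w n :
  e u v -> u \notin W -> pathl W v w n -> pathl (u |: W) u w n.+1.
Proof.
move=> euv uW [p /and5P[ep lp Up Wp sp]];
  have uvp: u \notin v :: p by apply: contra uW => /(allP Wp).
exists (v :: p); apply/and5P; split=> //.
- by rewrite /= euv.
- by rewrite cons_uniq uvp.
apply/andP; split; first by rewrite /= setU11.
exact: all_in_sub (subsetUr _ _) Wp.
Qed.

Lemma pathl_edge W u v : e u v -> u != v -> u \in W -> v \in W -> pathl W u v 1.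
Proof.
by move=> euv neq uW vW; exists [:: v];
  rewrite /pathp /= euv inE neq uW vW eqxx.
Qed.

Hypothesis e_sym : symmetric e.

Lemma pathl_rev W u v n : pathl W u v n -> pathl W v u n.
Proof.
case=> p /and5P[ep /eqP lp Up Wp /eqP sp]; exists (rev (belast u p)).
have E: v :: rev (belast u p) = rev (u :: p) by rewrite [in RHS]lastI lp
  rev_rcons.
apply/and5P; split; rewrite ?E ?rev_uniq ?all_rev ?size_rev ?size_belast ?sp //.
  by rewrite -lp rev_path (eq_path (e' := e)) // => z t; apply: e_sym.
by case: p lp {E ep Up Wp sp} => [|z p] /= lp;
  rewrite ?rev_cons ?last_rcons ?lp.
Qed.

End Paths.

Section Connectivity.
Variables (T : finType) (e : rel T).
Implicit Types (V W A B C D K : {set T}) (u v w x y : T) (p q : seq T).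

Lemma pathl_inv0 W u v : pathl e W u v 0 -> u = v.
Proof. by case=> p /and5P[_ /eqP<- _ _ /nilP->]. Qed.

Lemma pathl_inv W u v n : pathl e W u v n.+1 ->
  u \in W /\ exists2 w, e u w & pathl e (W :\ u) w v n.
Proof.
case=> -[|w p] /and5P[] //= /andP[euw ep] lp /andP[up Up] /andP[uW Wp] sp.
split=> //; exists w => //; exists p; apply/and5P; split=> //.
have {}Wp: all [in W] (w :: p) by [].
apply/allP=> z zp; rewrite /= in_setD1 (allP Wp z zp) andbT.
by apply: contraNneq up => <-.
Qed.

(** The path is cut at its first entry into [D]. That the initial part stays in [W :\: D] is what
    permits joining it to paths inside [D]. *)
Lemma pathl_exit W D u v n : pathl e W u v n -> u \notin D -> v \in D ->
  exists c d m, [/\ pathl e (W :\: D) u c m, e c d & d \in D :&: W].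
Proof.
elim: n W u => [|n IHn] W u uv uD vD.
  by rewrite (pathl_inv0 uv) vD in uD.
have [uW [w euw wv]] := pathl_inv uv; have [wW _] := pathl_ends wv.
have [wD | wD] := boolP (w \in D).
  exists u, w, 0; split; [|exact: euw|].
    by apply: pathl_refl; rewrite inE uD.
  by move: wW; rewrite !inE wD => /andP[].
have [c [d [m [uc ecd dDW]]]] := IHn _ _ wv wD vD.
exists c, d, m.+1; split=> //; last by move: dDW;
  rewrite !inE => /and3P[-> _ ->].
have us: u \notin W :\ u :\: D by rewrite !inE eqxx andbF.
apply: pathl_sub (pathl_cons euw us uc).
by apply/subsetP=> z; rewrite !inE => /orP[/eqP-> | /and3P[-> _ ->]] //;
  rewrite uD uW.
Qed.

(** In contrast to [pathl_cat], the sequence is kept, so that the path can be cut again at other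
    vertices. *)
Lemma pathl_seq A B W x v y m n :
    A \subset W -> B \subset W -> (forall z, z \in A -> z \in B -> z = v) ->
    pathl e A x v m -> pathl e B v y n ->
  exists2 p, pathp e W x y (m + n) p & v \in x :: p.
Proof.
move=> sAW sBW AB [p /and5P[ep /eqP lp Up Ap /eqP sp]].
move=> [q /and5P[eq /eqP lq Uq Bq /eqP sq]].
exists (p ++ q); last by rewrite -cat_cons mem_cat -lp mem_last.
apply/and5P; split.
- by rewrite cat_path lp ep.
- by rewrite last_cat lp lq.
- rewrite -cat_cons cat_uniq Up; move: Uq;
  rewrite cons_uniq => /andP[vq ->] /=; rewrite andbT.
  apply/hasPn=> z qz; apply: contra vq => pz.
  rewrite -(AB z) ?(allP Ap) //; by apply: (allP Bq); rewrite inE qz orbT.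
- rewrite -cat_cons all_cat (all_in_sub sAW Ap) /=.
  by have /andP[] := all_in_sub sBW Bq.
by rewrite size_cat sp sq.
Qed.

(** * Paths of prescribed length in cliques and complete bipartite graphs *)

Definition clique K := {in K &, forall a b, a != b -> e a b}.

Lemma cliqueS K A : A \subset K -> clique K -> clique A.
Proof. by move=> /subsetP sAK Kc a b /sAK aK /sAK; apply: Kc. Qed.

Lemma clique_path K u v n : clique K -> u \in K -> v \in K -> u != v ->
  0 < n < #|K| -> pathl e K u v n.
Proof.
elim: n K u => [|[|n] IHn] K u Kc uK vK neq_uv //.
  by move=> _; apply: pathl_edge => //; apply: Kc.
move=> /= n_lt; have : 0 < #|K :\ u :\ v|.
  have := cardsD1 u K; have := cardsD1 v (K :\ u).
  by rewrite uK !inE eq_sym neq_uv vK; lia.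
case/card_gt0P=> w; rewrite !inE => /and3P[wv wu wK].
rewrite -(setD1K uK); apply: (@pathl_cons _ _ _ _ w); first by apply: Kc;
  rewrite // eq_sym.
  by rewrite !inE eqxx.
apply: IHn; rewrite ?inE ?wu ?wK //; first exact: cliqueS (subD1set K u) Kc.
  by rewrite eq_sym neq_uv.
by have := cardsD1 u K; rewrite uK; lia.
Qed.

Lemma clique_path_to K v n : clique K -> v \in K -> n < #|K| ->
  exists2 u, u \in K & pathl e K u v n.
Proof.
move=> Kc vK; case: n => [|n] lt_n; first by exists v => //; apply: pathl_refl.
have : 0 < #|K :\ v| by have := cardsD1 v K; rewrite vK; lia.
case/card_gt0P=> u; rewrite !inE => /andP[uv uK].
by exists u => //; apply: clique_path.
Qed.

Hypothesis e_sym : symmetric e.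

Definition biclique A B := {in A & B, forall a b, e a b}.

Lemma biclique_path_odd i A B x t :
    biclique A B -> [disjoint A & B] -> x \in A -> t \in B ->
    i < #|A| -> i < #|B| -> pathl e (A :|: B) x t i.*2.+1.
Proof.
elim: i A B x t => [|i IHi] A B x t AB dAB xA tB ltA ltB.
  have xB := disjointFr dAB xA.
  apply: pathl_edge; rewrite ?inE ?xA ?tB ?orbT //; first exact: AB.
  by apply: contraFneq xB => ->.
have : 0 < #|A :\ x| by have := cardsD1 x A; rewrite xA; lia.
case/card_gt0P=> p; rewrite !inE => /andP[px pA].
have : 0 < #|B :\ t| by have := cardsD1 t B; rewrite tB; lia.
case/card_gt0P=> s; rewrite !inE => /andP[st sB].
have {}IHi: pathl e (A :\ x :|: B :\ s) p t i.*2.+1.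
  apply: IHi; rewrite ?inE ?px ?pA //.
  - by move=> a b; rewrite !inE => /andP[_ aA] /andP[_ bB]; apply: AB.
  - by apply: disjointWl (subD1set A x) _; apply: disjointWr (subD1set B s) dAB.
  - by rewrite eq_sym st.
  - by have := cardsD1 x A; rewrite xA; lia.
  by have := cardsD1 s B; rewrite sB; lia.
have sA := disjointFl dAB sB; have xB := disjointFr dAB xA.
have sp: e s p by rewrite e_sym; apply: AB.
have -> : A :|: B = x |: (s |: (A :\ x :|: B :\ s)).
  apply/setP=> z; rewrite !inE; case: (eqVneq z x) => [-> | _];
    first by rewrite xA.
  by case: (eqVneq z s) => [-> | _]; rewrite ?sB ?orbT.
have xs: x != s by apply: contraFneq xB => ->.
rewrite doubleS; apply: (@pathl_cons _ _ _ _ s); first exact: AB.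
  by rewrite !inE (negPf xs) eqxx xB andbF.
by apply: (@pathl_cons _ _ _ _ p); rewrite // !inE sA eqxx andbF.
Qed.

Lemma biclique_path_even i A B x u :
    biclique A B -> [disjoint A & B] -> x \in A -> u \in A -> x != u ->
    i.+1 < #|A| -> i < #|B| -> pathl e (A :|: B) x u i.*2.+2.
Proof.
move=> AB dAB xA uA xu ltA ltB.
have /card_gt0P[t tB] : 0 < #|B| by lia.
apply: pathl_rev => //.
have -> : A :|: B = u |: (A :\ u :|: B).
  by apply/setP=> z; rewrite !inE; case: eqVneq => [->|]; rewrite ?uA.
apply: (@pathl_cons _ _ _ _ t); first exact: AB.
  by rewrite !inE eqxx /= (disjointFr dAB uA).
apply: pathl_rev => //; apply: biclique_path_odd => //.
- by move=> a b; rewrite !inE => /andP[_ aA] bB; apply: AB.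
- exact: disjointWl (subD1set A u) dAB.
- by rewrite !inE xu.
by have := cardsD1 u A; rewrite uA; lia.
Qed.

(** * Components and boundaries in induced subgraphs *)

Definition er W := [rel a b | [&& e a b, a \in W & b \in W]].
Definition component W v := [set w | connect (er W) v w].
Definition conn C := {in C &, forall a b, connect (er C) a b}.

Lemma er_connect_sym W : connect_sym (er W).
Proof. by apply: sym_connect_sym => a b /=;
  rewrite e_sym [(b \in W) && _]andbC. Qed.

Lemma comp_refl W v : v \in component W v.
Proof. by rewrite inE connect0. Qed.

Lemma comp_sub W v : v \in W -> component W v \subset W.
Proof.
move=> vW; apply/subsetP=> w; rewrite inE => /connectP[p].
elim: p v vW => [|u p IHp] v vW /=; first by move=> _ ->.
by case/andP=> /and3P[_ _ uW]; apply: IHp.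
Qed.

Lemma comp_closed W v a b : v \in W -> a \in component W v -> b \in W ->
  e a b ->
  b \in component W v.
Proof.
move=> vW aC bW eab; have aW := subsetP (comp_sub vW) _ aC.
move: aC; rewrite !inE => /connect_trans-> //; apply: connect1.
by rewrite /= eab aW bW.
Qed.

Lemma comp_conn W v : v \in W -> conn (component W v).
Proof.
move=> vW; have vw (w : T) : w \in component W v ->
  connect (er (component W v)) v w.
  rewrite inE => /connectP[p]; elim/last_ind: p w => [|p u IHp] w /=.
    by move=> _ ->; apply: connect0.
  rewrite rcons_path last_rcons => /andP[ep eu] wE; subst w.
  have lastC : last v p \in component W v by rewrite inE; apply/connectP;
    exists p.
  have uC: u \in component W v.
    by case/and3P: eu => elu _ uW; apply: comp_closed elu.
  apply: connect_trans (IHp _ ep erefl) _; apply: connect1.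
  by case/and3P: eu => elu _ _; rewrite /= elu lastC uC.
move=> a b aC bC; apply: connect_trans (vw b bC).
by rewrite er_connect_sym; apply: vw.
Qed.

Lemma conn_path C a b : conn C -> a \in C -> b \in C ->
  exists n, pathl e C a b n.
Proof.
move=> Cc aC bC; have /connectP[p ep ->] := Cc a b aC bC.
case/shortenP: ep => q eq Uq _; exists (size q), q; apply/and5P; split=> //.
  by apply: sub_path eq => u v /and3P[].
rewrite /= aC; elim: q (a) {Uq} eq =>
  //= u q IHq v /andP[/and3P[_ _ uC] /IHq->].
by rewrite uC.
Qed.

Lemma conn_bd C D r : conn C -> D \subset C -> D != set0 -> r \in C ->
  r \notin D -> bd e C D != set0.
Proof.
move=> Cc sDC /set0Pn[d dD] rC rD; apply: contraNneq rD => bd0.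
have cl: closed (er C) (mem D).
  have clD (a b : T) : er C a b -> a \in D -> b \in D.
    case/and3P=> eab aC bC aD; apply: contraT => bD.
    have : b \in bd e C D by apply/bdP; split=> //; exists a.
    by rewrite bd0 inE.
  move=> a b ab; apply/idP/idP; first exact: clD.
  by apply: clD; move: ab; rewrite /= e_sym [(b \in C) && _]andbC.
by rewrite -(closed_connect cl (Cc d r (subsetP sDC _ dD) rC)).
Qed.

(** The component of [r] in [C :\: D] has a boundary vertex in the connected set [C], and this must
    lie in [D]. Its neighbour in the component is then on the boundary of [D], hence is [c]. *)
Lemma conn_path_avoid C D c r : conn C -> D \subset C -> D != set0 ->
  r \in C -> r \notin D -> bd e C D \subset [set c] ->
  exists m, pathl e (C :\: D) c r m.
Proof.
move=> Cc sDC D0 rC rD bdc; have rW: r \in C :\: D by rewrite inE rD.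
have [cY | cY] := boolP (c \in component (C :\: D) r).
  have [m p] := conn_path (comp_conn rW) cY (comp_refl _ _).
  by exists m; apply: pathl_sub p; apply: comp_sub.
have sY := subsetP (comp_sub rW); case/set0Pn: (D0) => d dD.
have /set0Pn[w /bdP[wC wY [v vY evw]]] : bd e C (component (C :\: D) r) != set0.
  apply: (@conn_bd C _ d) => //; first by apply/subsetP=> z /sY;
    rewrite inE => /andP[].
  - by apply/set0Pn; exists r; apply: comp_refl.
  - exact: (subsetP sDC).
  by apply: contraL dD => /sY; rewrite inE => /andP[].
have [wD | wD] := boolP (w \in D); last first.
  by rewrite (comp_closed rW vY _ evw) // inE wD in wY.
have : v \in bd e C D.
  have := sY _ vY; rewrite inE => /andP[vD vC].
  by apply/bdP; split=> //; exists w => //; rewrite e_sym.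
by move/(subsetP bdc); rewrite inE => /eqP vc; rewrite -vc vY in cY.
Qed.

(* Together with V <> {x, y}, this says that the graph induced on V, with the
   edge xy added, is 2-connected. *)
Definition rooted V x y :=
  forall D, D != set0 -> D \subset V :\: [set x; y] -> 1 < #|bd e V D|.

Lemma rooted_sym V x y : rooted V x y -> rooted V y x.
Proof. by move=> H D; rewrite [[set y; x]]setUC; apply: H. Qed.

(** Otherwise the component of [v] in [V :\ c] contains no root, while its boundary is inside
    [[set c]]. *)
Lemma rooted_reach V x y c v : rooted V x y -> v \in V -> v != c ->
  exists r n, [/\ r \in [set x; y], r != c & pathl e (V :\ c) v r n].
Proof.
move=> Vr vV vc; have vW: v \in V :\ c by rewrite !inE vc.
have sY := subsetP (comp_sub vW).
have reach (r : T) : r \in [set x; y] -> r \in component (V :\ c) v ->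
    exists r n, [/\ r \in [set x; y], r != c & pathl e (V :\ c) v r n].
  move=> rxy rY; have [n p] := conn_path (comp_conn vW) (comp_refl _ _) rY.
  exists r, n; split=> //; first by have := sY _ rY; rewrite !inE => /andP[].
  by apply: pathl_sub p; apply: comp_sub.
have [|xY] := boolP (x \in component (V :\ c) v); first by apply: reach;
  rewrite !inE eqxx.
have [|yY] := boolP (y \in component (V :\ c) v); first by apply: reach;
  rewrite !inE eqxx orbT.
suff : #|bd e V (component (V :\ c) v)| <= 1.
  rewrite leqNgt Vr //; first by apply/set0Pn; exists v; apply: comp_refl.
  apply/subsetP=> z zY; rewrite in_setD; move: (sY _ zY);
    rewrite !inE => /andP[_ ->].
  rewrite andbT; apply: contraL zY => /orP[]/eqP->; first exact: xY.
  exact: yY.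
rewrite -(cards1 c); apply/subset_leq_card/subsetP=> w /bdP[wV wY [u uY euw]].
rewrite inE; apply: contraNT wY => wc; apply: comp_closed euw => //.
by rewrite !inE wc.
Qed.

End Connectivity.

(** * Disjoint paths from the two roots *)

Section Linkage.
Variables (T : finType) (e : rel T).
Hypothesis e_sym : symmetric e.
Implicit Types (V W A B C D K : {set T}) (u v w x y : T) (p q : seq T).

(** A path from [x] to [y] through [v], held as two halves with explicit vertex sets so that each
    can be rerouted separately. *)
Definition crossed V x y v := exists A B m n,
  [/\ A \subset V, B \subset V, forall z, z \in A -> z \in B -> z = v,
      pathl e A x v m & pathl e B v y n].

(** The segment between [a] and [b] is dropped to make room for a detour. The disjunction is there
    because their order along the path is unknown. *)
Lemma pathp_split V x y n p a b :
    pathp e V x y n p -> a \in x :: p -> b \in x :: p -> a != b ->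
  exists A B k l, [/\ A \subset [set z in x :: p], B \subset [set z in x :: p],
      [disjoint A & B]
    & (pathl e A x a k /\ pathl e B b y l) \/ (pathl e A x b k /\ pathl e B a y
      l)].
Proof.
move=> /and5P[ep /eqP lp Up _ _] ap.
have main s t : path e x (s ++ t) -> last x (s ++ t) = y ->
  uniq (x :: s ++ t) ->
    forall c, c \in x :: s -> forall d t1 t2, t = t1 ++ d :: t2 ->
    exists A B k l, [/\ A \subset [set z in x :: s ++ t],
      B \subset [set z in x :: s ++ t], [disjoint A & B],
      pathl e A x c k & pathl e B d y l].
  move=> est lst Ust c /splitPl cs d t1 t2 tE.
  case: cs est lst Ust => s1 s2 <- est lst Ust.
  have sE: x :: (s1 ++ s2) ++ t = (x :: s1) ++ (s2 ++ t1) ++ (d :: t2).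
    by rewrite tE -!catA.
  exists [set z in x :: s1], [set z in d :: t2], (size s1), (size t2).
  have sub1: {subset x :: s1 <= x :: (s1 ++ s2) ++ t}.
    by move=> z; rewrite sE mem_cat => ->.
  have sub2: {subset d :: t2 <= x :: (s1 ++ s2) ++ t}.
    by move=> z; rewrite sE !mem_cat => ->; rewrite !orbT.
  move: Ust; rewrite sE cat_uniq => /and3P[U1 h1];
    rewrite cat_uniq => /and3P[_ _ U2].
  split.
  - by apply/subsetP=> z; rewrite inE => /sub1 h; rewrite -sE inE.
  - by apply/subsetP=> z; rewrite inE => /sub2 h; rewrite -sE inE.
  - apply/pred0P=> z; rewrite /= !in_set; apply: contraNF h1 => /andP[z1 z2].
    by apply/hasP; exists z; rewrite // mem_cat z2 orbT.
  - exists s1; apply/and5P; split=> //; last by apply/allP=> z; rewrite in_set.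
    by move: est; rewrite -catA cat_path => /andP[].
  exists t2; apply/and5P; split=> //; last by apply/allP=> z; rewrite in_set.
    move: est; rewrite tE -!catA !cat_path /=.
    by case/and3P=> _ _ /and3P[].
  by move: lst; rewrite tE last_cat last_cat /= => ->.
case/splitPl: ap Up ep lp => s t lx Up ep lp bp ab.
have E: x :: s ++ t = (x :: s) ++ t by [].
move: bp; rewrite E mem_cat; case: (boolP (b \in x :: s)) => /= [bs _ | _ bt].
  have: a \in x :: s by rewrite -lx mem_last.
  case/splitPl: bs lx Up ep lp {E} => s1 s2 lb lx Up ep lp as_.
  have a2: a \in s2.
    have lE: last b s2 = a by rewrite -lb -last_cat.
    by have := mem_last b s2; rewrite lE inE (negPf ab).
  case/splitPr: a2 lx Up ep lp {as_} => t1 t2 lx Up ep lp.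
  have [|||||A [B [k [l [h1 h2 h3 h4 h5]]]]] :=
    @main s1 ((t1 ++ a :: t2) ++ t) _ _ _ b _ a t1 (t2 ++ t).
  - by rewrite (catA s1).
  - by rewrite (catA s1).
  - by rewrite (catA s1).
  - by rewrite -lb mem_last.
  - by rewrite -catA.
  by exists A, B, k, l; rewrite -catA; split=> //; right.
case/splitPr: bt Up ep lp {E} => t1 t2 Up ep lp.
have [|||||A [B [k [l [h1 h2 h3 h4 h5]]]]] :=
  @main s (t1 ++ b :: t2) _ _ _ a _ b t1 t2.
- by [].
- by [].
- by [].
- by rewrite -lx mem_last.
- by [].
by exists A, B, k, l; split=> //; left.
Qed.

Variables (V : {set T}) (x y : T).
Hypotheses (xV : x \in V) (yV : y \in V).
Hypothesis Vxy : rooted e V x y.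

(* If w is not on a path from x to y through v, a path from w to {x, y} avoiding
   v first meets that path before or after v, and can be spliced in. *)
Lemma crossed_step v w : crossed V x y v -> w \in V -> e v w -> crossed V x y w.
Proof.
move=> [A [B [m [n [sA sB AB pA pB]]]]] wV evw.
have [p pP vp] := pathl_seq sA sB AB pA pB.
have sP: [set z in x :: p] \subset V.
  by case/and5P: pP => _ _ _ /allP pV _; apply/subsetP=> z; rewrite inE => /pV.
have [wp | wp] := boolP (w \in x :: p).
  case/and5P: (pP) => ep /eqP lp Up Vp _.
  case/splitPl: wp ep lp Up Vp {pP sP vp} => p1 p2 lw ep lp Up Vp.
  exists [set z in x :: p1], [set z in w :: p2], (size p1), (size p2); split.
  - by apply/subsetP=> z; rewrite inE => zp; apply: (allP Vp);
    rewrite -cat_cons mem_cat zp.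
  - apply/subsetP=> z; rewrite inE => zp; apply: (allP Vp);
    rewrite -cat_cons mem_cat.
    by move: zp; rewrite inE => /orP[/eqP-> | ->];
      rewrite ?orbT // -lw mem_last.
  - move=> z; rewrite !in_set => z1 z2; apply/eqP; move: z2; rewrite inE.
    case/orP=> // z2; move: Up;
      rewrite -cat_cons cat_uniq => /and3P[_ /hasPn h _].
    by have := h _ z2; rewrite /= z1.
  - exists p1; apply/and5P; split; rewrite ?lw //.
    + by move: ep; rewrite cat_path => /andP[].
    + by move: Up; rewrite -cat_cons cat_uniq => /and3P[].
    by apply/allP=> z; rewrite /= in_set.
  exists p2; apply/and5P; split=> //.
  - by move: ep; rewrite cat_path lw => /andP[].
  - by move: lp; rewrite last_cat lw => ->.
  - move: Up; rewrite -cat_cons cat_uniq => /and3P[_ /hasPn h Up2].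
    rewrite cons_uniq Up2 andbT; apply/negP=> /h; rewrite /= -lw mem_last.
    by [].
  by apply/allP=> z; rewrite /= in_set.
have wv: w != v by apply: contraNneq wp => ->.
have [r [l [rxy rv pr]]] := rooted_reach e_sym Vxy wV wv.
have xyp: r \in x :: p.
  case/and5P: pP => _ /eqP lp _ _ _; move: rxy; rewrite in_set2.
  by case/orP=> /eqP->; rewrite ?mem_head // -lp mem_last.
have [c [z [k [pc ecz]]]] : exists c z k,
    [/\ pathl e (V :\ v :\: [set z in x :: p]) w c k, e c z
      & z \in [set z in x :: p] :&: (V :\ v)].
  by apply: pathl_exit pr _ _; rewrite in_set.
rewrite inE in_set => /andP[zp]; rewrite !inE => /andP[zv zV].
have [A1 [B1 [k1 [l1 [s1 s2 d12 h]]]]] :=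
  pathp_split pP vp zp (negbT (introF eqP (nesym (elimN eqP zv)))).
pose W := V :\ v :\: [set z in x :: p].
have sW: W \subset V by apply/subsetP=> u; rewrite !inE => /and3P[].
have sAV := subset_trans s1 sP; have sBV := subset_trans s2 sP.
have W1 u: u \in A1 -> u \in W -> false.
  by move=> /(subsetP s1) up; rewrite in_setD up.
have W2 u: u \in B1 -> u \in W -> false.
  by move=> /(subsetP s2) up; rewrite in_setD up.
have wW := (pathl_ends pc).1; have cW := (pathl_ends pc).2.
have sub1 D : D \subset V -> [set w] :|: D \subset V.
  by move=> sD; rewrite subUset sub1set wV.
case: h => [] [pv pz].
  exists (w |: A1), (W :|: B1), k1.+1, (k + l1.+1); split=> //.
  - exact: sub1.
  - by rewrite subUset sW.
  - move=> u; rewrite in_setU1 in_setU => /orP[/eqP-> // | uA] /orP[uW | uB].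
      by have := W1 _ uA uW.
    by have := disjointFr d12 uA; rewrite uB.
  - apply: pathl_rev => //; apply: pathl_cons; last exact: pathl_rev pv.
      by rewrite e_sym.
    by apply/negP=> uA; have := W1 _ uA wW.
  have -> : W :|: B1 = W :|: (c |: B1).
    by apply/setP=> u; rewrite !in_setU in_set1; case: eqVneq => // ->;
      rewrite cW.
  apply: pathl_cat pc _; last apply: pathl_cons ecz _ pz.
    by move=> u uW; rewrite in_setU1 => /orP[/eqP // | /W2]; move/(_ uW).
  by apply/negP=> uA; have := W2 _ uA cW.
exists (W :|: A1), (w |: B1), (k1.+1 + k), l1.+1; split=> //.
- by rewrite subUset sW.
- exact: sub1.
- move=> u; rewrite in_setU1 in_setU => /orP[uW | uA] /orP[/eqP // | uB].
    by have := W2 _ uB uW.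
  by have := disjointFr d12 uA; rewrite uB.
- rewrite addnC; apply: pathl_rev => //.
  have -> : W :|: A1 = W :|: (c |: A1).
    by apply/setP=> u; rewrite !in_setU in_set1; case: eqVneq => // ->;
      rewrite cW.
  apply: pathl_cat pc _; last first.
    apply: pathl_cons ecz _ (pathl_rev e_sym pv).
    by apply/negP=> uA; have := W1 _ uA cW.
  by move=> u uW; rewrite in_setU1 => /orP[/eqP // | /W1]; move/(_ uW).
apply: pathl_cons; last exact: pz.
  by rewrite e_sym.
by apply/negP=> uA; have := W2 _ uA wW.
Qed.

Hypothesis Vxy0 : V :\: [set x; y] != set0.

(** Avoiding [x] leads every other vertex to [y]; avoiding [y] leads an inner vertex to [x], which
    joins the two roots. *)
Lemma rooted_conn : conn e V.
Proof.
have reach u c : u \in V -> u != c -> exists2 r, r \in [set x;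
  y] & r != c /\ connect (er e V) r u.
  move=> uV uc; have [r [n [rxy rc pr]]] := rooted_reach e_sym Vxy uV uc.
  exists r => //; split=> //;
    have [q /and5P[eq /eqP<- _ Vq _]] := pathl_rev e_sym pr.
  apply/connectP; exists q => //; have {}Vq: all [in V] (r :: q).
    exact: all_in_sub (subD1set _ _) Vq.
  elim: q r {rxy rc pr} eq Vq => //= w q IHq r /andP[erw eq] /and3P[rV wV qV].
  by rewrite erw rV wV IHq // wV.
have toy u : u \in V -> u != x -> connect (er e V) y u.
  move=> uV ux; have [r] := reach u x uV ux; rewrite in_set2.
  by case/orP=> /eqP-> [] // /eqP.
have cyx: connect (er e V) y x.
  case/set0Pn: Vxy0 => v; rewrite !inE negb_or => /andP[/andP[vx vy] vV].
  have [r] := reach v y vV vy; rewrite in_set2.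
  case/orP=> /eqP-> [] // => [_ |/eqP //].
  rewrite (er_connect_sym e_sym V x); apply: connect_trans; exact: toy.
have all_y u : u \in V -> connect (er e V) y u.
  by move=> uV; case: (eqVneq u x) => [-> // | /toy->].
move=> a b aV bV; apply: connect_trans (all_y b bV).
by rewrite (er_connect_sym e_sym); apply: all_y.
Qed.

Lemma crossed_all v : v \in V -> crossed V x y v.
Proof.
move=> vV; have /connectP[p] := rooted_conn xV vV.
have : crossed V x y x.
  have [n p0] := conn_path rooted_conn xV yV.
  exists [set x], V, 0, n; split=> //; first by rewrite sub1set.
    by move=> z; rewrite inE => /eqP.
  by apply: pathl_refl; rewrite inE.
elim: p {2 3 4}x => [|w p IHp] u xu /=; first by move=> _ ->.
case/andP=> /and3P[euw uV wV] ep lw; apply: (IHp w) => //.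
exact: crossed_step euw.
Qed.

(** This is Menger's theorem for two paths. A path from [x] to [y] through a vertex of [D] is
    followed from both ends until just before it enters [D]; its two halves share only a vertex of
    [D], so the remaining parts are disjoint. *)
Lemma link D : D != set0 -> D \subset V :\: [set x; y] ->
  exists A B c d m n,
  [/\ A \subset V :\: D, B \subset V :\: D, [disjoint A & B],
      [/\ c \in bd e V D, d \in bd e V D & c != d]
    & pathl e A x c m /\ pathl e B d y n].
Proof.
move=> /set0Pn[v vD] sD.
have notD r: r \in [set x; y] -> r \notin D.
  by move=> rxy; apply: contraL rxy => /(subsetP sD); rewrite inE => /andP[].
have vV: v \in V by have := subsetP sD v vD; rewrite inE => /andP[].
have [A [B [m [n [sA sB AB pA pB]]]]] := crossed_all vV.
have xD: x \notin D by rewrite notD ?set21.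
have yD: y \notin D by rewrite notD ?set22.
have [c [c' [k [pc ecc]]]] := pathl_exit pA xD vD.
have [d [d' [l [pd edd]]]] := pathl_exit (pathl_rev e_sym pB) yD vD.
rewrite !inE => /andP[dD _] /andP[cD _].
have AB' z : z \in A :\: D -> z \in B :\: D -> false.
  by rewrite !inE => /andP[zD zA] /andP[_ /(AB z zA) zv]; rewrite zv vD in zD.
exists (A :\: D), (B :\: D), c, d, k, l; split.
- exact: setSD.
- exact: setSD.
- by apply/pred0P=> z; apply/negP=> /andP[zA zB]; have := AB' z zA zB.
- have [_ cA] := pathl_ends pc; have [_ dB] := pathl_ends pd.
  split; last by apply: contraTneq cA => ->; apply/negP=> dA;
    have := AB' _ dA dB.
    move: cA; rewrite inE => /andP[cD' /(subsetP sA) cV].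
    by apply/bdP; split=> //; exists c'; rewrite // e_sym.
  move: dB; rewrite inE => /andP[dD' /(subsetP sB) dV].
  by apply/bdP; split=> //; exists d'; rewrite // e_sym.
by split=> //; apply: pathl_rev.
Qed.

End Linkage.

(** * Rooted graphs and contractions *)

Section RootedGraphs.
Variable T : finType.
Implicit Types (e : rel T) (V X : {set T}) (x y : T).

(* The set X holds the exceptional vertex of small degree, which is only needed
   for k = 2.  For k <= 1, there is no condition on degrees. *)
Record rooted_graph e V x y k X : Prop := RootedGraph {
  rg_sym : symmetric e;
  rg_irr : irreflexive e;
  rg_x : x \in V;
  rg_y : y \in V;
  rg_xy : x != y;
  rg_rooted : rooted e V x y;
  rg_X : #|X| <= (k <= 2);
  rg_inner : ~~ (V :\: [set x; y] \subset X);
  rg_deg v : v \in V :\: [set x; y] -> v \notin X -> 1 < k -> k < #|nb e V v| }.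

Definition admissible_paths e V x y k := progression k (fun n =>
  2 <= n /\ pathl e V x y n).

Lemma admissible_paths_sym e V x y k : symmetric e ->
  admissible_paths e V y x k -> admissible_paths e V x y k.
Proof. by move=> e_sym;
  apply: progression_imply => n [n2 /(pathl_rev e_sym)]. Qed.

Lemma pathl_rel e e' (W : {set T}) u v n :
  {in W &, forall a b, e' a b -> e a b} -> pathl e' W u v n -> pathl e W u v n.
Proof.
move=> ee' [p /and5P[ep lp Up Wp sp]]; exists p; apply/and5P; split=> //.
elim: p u ep Wp {lp Up sp} => //= w p IHp u /andP[euw ep] /and3P[uW wW pW].
by rewrite ee' //= IHp //= wW.
Qed.

End RootedGraphs.

(** * Contraction of the exit set *)

Section Contraction.
Variables (T : finType) (e : rel T) (V : {set T}).
Hypotheses (e_sym : symmetric e) (e_irr : irreflexive e).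
Hypothesis IH : forall e' (V' : {set T}) x' y' k' X', #|V'| < #|V| ->
  rooted_graph e' V' x' y' k' X' -> admissible_paths e' V' x' y' k'.
Implicit Types (A B C D H K S U W X : {set T}) (x y r u v w : T).

Definition hit U v := [exists u in U, e u v].

Lemma hitP U v : reflect (exists2 u, u \in U & e u v) (hit U v).
Proof. exact: exists_inP. Qed.

(* The vertex x, which is not in C, stands for the set U once contracted, so that
   the smaller graph has vertices in the same type. *)
Lemma contraction C U x r k X :
    x \in V -> x \notin C -> C \subset V -> r \in C ->
    U \subset V -> [disjoint U & C] -> x \notin U -> U != set0 ->
    (forall D, D != set0 -> D \subset C :\ r -> bd e C D != set0) ->
    (forall D, D != set0 -> D \subset C :\ r ->
      {in D, forall v, ~~ hit U v} -> 1 < #|bd e C D|) ->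
    #|X| <= (k <= 2) -> ~~ (C :\ r \subset X) ->
    (forall v, v \in C :\ r -> v \notin X -> 1 < k ->
      k < #|nb e C v| + hit U v) ->
  progression k (fun n => 2 <= n /\ exists2 u, u \in U
    & pathl e (u |: C) u r n).
Proof.
move=> xV xC sCV rC sUV dUC xU U0 bd1 bd2 cX sX degC.
pose e' a b := [|| [&& e a b, a \in C & b \in C],
   [&& a == x, b \in C & hit U b] | [&& b == x, a \in C & hit U a]].
have eE : {in C &, forall a b, e' a b = e a b}.
  move=> a b aC bC; rewrite /e' aC bC !andbT /=.
  have /negPf-> : a != x by apply: contraNneq xC => <-.
  have /negPf-> : b != x by apply: contraNneq xC => <-.
  by rewrite /= orbF.
have xrC : (x |: C) :\: [set x; r] = C :\ r.
  apply/setP=> z; rewrite !inE negb_or; case: eqVneq => // ->.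
  by rewrite (negPf xC) andbF.
have V'lt : #|x |: C| < #|V|.
  apply: proper_card; apply/properP; split; first by rewrite subUset sub1set xV.
  case/set0Pn: U0 => u uU; exists u; first exact: (subsetP sUV).
  rewrite !inE negb_or (disjointFr dUC uU) andbT.
  by apply: contraNneq xU => <-.
have sub_bd D : D \subset C :\ r -> bd e C D \subset bd e' (x |: C) D.
  move=> sD; apply/subsetP=> w /bdP[wC wD [v vD evw]]; apply/bdP; split=> //.
    by rewrite inE wC orbT.
  by exists v => //; rewrite eE //; move: (subsetP sD v vD);
    rewrite inE => /andP[].
have RG : rooted_graph e' (x |: C) x r k X.
  split; rewrite ?xrC //.
  - move=> a b; rewrite /e' e_sym [(b \in C) && (a \in C)]andbC.
    by congr (_ || _); rewrite orbC.
  - move=> a; rewrite /e' e_irr /= orbb; apply/negP=> /and3P[/eqP->].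
    by rewrite (negPf xC).
  - exact: setU11.
  - by rewrite inE rC orbT.
  - by apply: contraNneq xC => ->.
  (* If [U] sees [D], the new root is one boundary vertex and the first hypothesis on boundaries
     gives another; if not, the second one applies. *)
  - move=> D D0; rewrite xrC => sD; have sb := sub_bd _ sD.
    have [|] := boolP [exists v in D, hit U v]; last first.
      move/exists_inPn=> noh; apply: leq_trans (subset_leq_card sb).
      exact: bd2.
    case/exists_inP=> v vD hv.
    have xb : x \notin bd e C D by apply: contra xC => /bdP[].
    have /card_gt0P[w wb] : 0 < #|bd e C D| by rewrite card_gt0 bd1.
    have -> : 1 < #|bd e' (x |: C) D| = (#|[set x; w]| <= #|bd e' (x |: C) D|).
      by rewrite cards2; have -> : x != w by apply: contraNneq xb => ->.
    apply/subset_leq_card; rewrite subUset !sub1set (subsetP sb w wb) andbT.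
    have vC : v \in C by move: (subsetP sD v vD); rewrite inE => /andP[].
    apply/bdP; split; first exact: setU11.
      by apply: contra xC => /(subsetP sD); rewrite inE => /andP[].
    by exists v => //; rewrite /e' eqxx vC hv !orbT.
  move=> v vC vX k1; apply: leq_trans (degC v vC vX k1) _.
  have {}vC : v \in C by move: vC; rewrite inE => /andP[].
  have sub : nb e C v \subset nb e' (x |: C) v.
    apply/subsetP=> w; rewrite !in_nb => /andP[wC evw].
    by rewrite inE wC orbT eE.
  case: (boolP (hit U v)) => hv /=; last by rewrite addn0 subset_leq_card.
  have xb : x \notin nb e C v by rewrite in_nb (negPf xC).
  rewrite addnC -[true + _]/(_ + _) (_ : _ + _ = #|x |: nb e C v|);
    last by rewrite cardsU1 xb.
  apply/subset_leq_card; rewrite subUset sub sub1set andbT in_nb setU11 /=.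
  by rewrite /e' eqxx vC hv !orbT.
(* The first edge of the path leads from the new root to a vertex seen by some [u] in [U]; this [u]
   replaces the root. *)
apply: progression_imply (IH V'lt RG) => n [n2 pn]; split=> //.
case: n n2 pn => // n _ /pathl_inv[_ [w exw pn]].
have /andP[wC /hitP[u uU euw]] : (w \in C) && hit U w.
  by move: exw; rewrite /e' (negPf xC) eqxx /= ?andbF ?orbF.
exists u => //; apply: pathl_cons;
  [exact: euw | by rewrite (disjointFr dUC uU) |].
have sVC : (x |: C) :\ x \subset C.
  by apply/subsetP=> z; rewrite !inE; case: eqVneq.
apply: pathl_rel (pathl_sub sVC pn) => a b aC bC; rewrite eE //.
Qed.

(** The path through [C] decides which [u] is used, and every length in [H] is available for that
    [u]. The tail from [r] to [y] shifts all lengths alike. *)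
Lemma combine s t k C H U Y x r y m :
    0 < s -> 0 < t -> k < s + t ->
    progression s (fun n => {in U, forall u, pathl e H x u n}) ->
    progression t (fun n => 2 <= n /\ exists2 u, u \in U
      & pathl e (u |: C) u r n) ->
    [disjoint H & C] -> pathl e Y r y m ->
    (forall z, z \in H :|: C -> z \in Y -> z = r) ->
    H :|: C :|: Y \subset V ->
  admissible_paths e V x y k.
Proof.
move=> s0 t0 kst APs APt dHC Yry HCY sV.
have APk : progression k (fun n => 2 <= n /\ pathl e (H :|: C) x r n).
  apply: progression_add s0 t0 kst _ APs APt => a b Ha [b2 [u uU Hb]]; split;
    first by lia.
  have -> : H :|: C = H :|: (u |: C).
    have [_ uH] := pathl_ends (Ha u uU).
    by apply/setP=> z; rewrite !inE; case: eqVneq => // ->; rewrite uH.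
  apply: pathl_cat (Ha u uU) Hb => z zH; rewrite !inE => /orP[/eqP// | zC].
  by rewrite (disjointFr dHC zH) in zC.
apply: (progression_shift (m := m)) APk => n [n2 pn]; split; first by lia.
exact: pathl_sub sV (pathl_cat HCY pn Yry).
Qed.

Lemma nb_card_split A B v : nb e V v \subset A :|: B ->
  #|nb e V v| <= #|nb e A v| + #|nb e B v|.
Proof.
move=> sAB; apply: leq_trans (leq_card_setU _ _); apply/subset_leq_card.
apply/subsetP=> w wv; have := subsetP sAB w wv; move: wv.
by rewrite !inE => /andP[_ ->] /orP[]->; rewrite ?orbT.
Qed.

(* A piece D of C that only c separates from r and that is otherwise attached to R:
   for R = H :\: U, it is what prevents the graph obtained from C by
     contracting U
   from being 2-connected. *)
Definition bad_piece C r R D c := [&& D != set0, D \subset C :\ r, c \in C,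
  bd e C D \subset [set c] & bd e V D \subset c |: R].

(** In a component, no set that avoids [r] has an empty boundary. A set not seen by [U] with one
    boundary vertex in [C] can have its other neighbours only in [H :\: U], so it is a bad piece. *)
Lemma contraction_component W H U x r k X (C := component e (W :\: H) r) :
    W \subset V -> H \subset W -> U \subset H -> x \in H -> x \notin U ->
    U != set0 -> r \in W -> r \notin H ->
    (forall v, v \in C :\ r -> nb e V v \subset W) ->
    #|X| <= (k <= 2) -> ~~ (C :\ r \subset X) ->
    (forall v, v \in C :\ r -> v \notin X -> nb e V v \subset C :|: H ->
      1 < k -> k < #|nb e C v| + hit U v) ->
  (exists D c, bad_piece C r (H :\: U) D c) \/
  progression k (fun n => 2 <= n /\ exists2 u, u \in U
    & pathl e (u |: C) u r n).
Proof.
move=> sWV sHW sUH xH xU U0 rW rH nbW cX sX degC.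
have rWH : r \in W :\: H by rewrite inE rH.
have sCW := comp_sub e rWH; have conC := comp_conn e_sym rWH.
have CW z : z \in C -> z \in W by move/(subsetP sCW); rewrite inE => /andP[].
have CH z : z \in C -> z \notin H by move/(subsetP sCW); rewrite inE => /andP[].
have nbC v : v \in C :\ r -> nb e V v \subset C :|: H.
  move=> vC; have {}sW := subsetP (nbW v vC).
  apply/subsetP=> w wv; rewrite inE orbC; case: (boolP (w \in H)) => //= wH.
  move: vC wv; rewrite inE in_nb => /andP[_ vC] /andP[wV evw].
  apply: comp_closed vC _ (evw) => //; rewrite inE wH sW // in_nb wV;
    exact: evw.
have [/existsP[D /existsP[c Dc]] | nobad] :=
  boolP [exists D : {set T}, [exists c, bad_piece C r (H :\: U) D c]].
  by left; exists D, c.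
right; have bd1 D : D != set0 -> D \subset C :\ r -> bd e C D != set0.
  move=> D0 sD; apply: (conn_bd e_sym conC (r := r)) => //.
  - exact: subset_trans sD (subD1set _ _).
  - exact: comp_refl.
  by apply/negP=> /(subsetP sD); rewrite !inE eqxx.
apply: (@contraction C U x r k X) => //.
- exact: (subsetP sWV _ (subsetP sHW _ xH)).
- by apply/negP=> /CH; rewrite xH.
- by apply/subsetP=> z /CW/(subsetP sWV).
- exact: comp_refl.
- exact: subset_trans sUH (subset_trans sHW sWV).
- by apply/pred0P=> z; apply/negP=> /andP[/(subsetP sUH) zH /CH]; rewrite zH.
- move=> D D0 sD noh; rewrite ltnNge; apply: contraNN nobad => le1.
  have /set0Pn[c cb] := bd1 D D0 sD.
  have bdc : bd e C D \subset [set c].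
    have /eqP-> // : [set c] == bd e C D.
    by rewrite eqEcard sub1set cb cards1.
  apply/existsP; exists D; apply/existsP; exists c; apply/and5P; split=> //.
    by have /bdP[] := cb.
  apply/subsetP=> w /bdP[wV wD [v vD evw]].
  have := subsetP (nbC v (subsetP sD v vD)) w;
    rewrite in_nb wV evw inE => /(_ isT).
  rewrite in_setU1; case/orP=> [wC | wH].
    have : w \in bd e C D by apply/bdP; split=> //; exists v.
    by move/(subsetP bdc); rewrite inE => ->.
  rewrite inE wH andbT; case: (boolP (w \in U)) => [wU | _];
    last by rewrite orbT.
  by case/negP: (noh v vD); apply/hitP; exists w; rewrite // e_sym.
by move=> v vC vX k1; apply: degC => //; apply: nbC.
Qed.

End Contraction.

(** * Reduced rooted graphs and separations of order 3 *)

Section Reductions.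
Variables (T : finType) (e : rel T) (V X : {set T}) (k : nat).
Hypotheses (e_sym : symmetric e) (e_irr : irreflexive e).
Hypothesis IH : forall e' (V' : {set T}) x' y' k' X', #|V'| < #|V| ->
  rooted_graph e' V' x' y' k' X' -> admissible_paths e' V' x' y' k'.
Hypotheses (k_gt1 : 1 < k) (cX : #|X| <= (k <= 2)).
Implicit Types (A B C D H K S U W : {set T}) (x y r u v w : T).

Notation N := (nb e V).

(** What remains after deleting an edge between the roots and treating 2-separations. Sets inside
    [X] are exempt from [reduced_three], since a rooted graph on such a set would have no inner
    vertex outside [X]. *)
Record reduced x y : Prop := Reduced {
  reduced_x : x \in V;
  reduced_y : y \in V;
  reduced_neq : x != y;
  reduced_nadj : e x y = false;
  reduced_rooted : rooted e V x y;
  reduced_three D : D != set0 -> D \subset V :\: [set x; y] ->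
    ~~ (V :\: [set x; y] \subset D) -> ~~ (D \subset X) -> 2 < #|bd e V D|;
  reduced_inner : ~~ (V :\: [set x; y] \subset X);
  reduced_deg v : v \in V :\: [set x; y] -> v \notin X -> k < #|N v| }.

Lemma reduced_sym x y : reduced x y -> reduced y x.
Proof.
case=> xV yV neq nadj rt th inn dg; split; rewrite ?[[set y; x]]setUC //.
- by rewrite eq_sym.
- by rewrite e_sym.
exact: rooted_sym.
Qed.

Lemma X_eq0 : 2 < k -> X = set0.
Proof. by move=> k2; apply/eqP; rewrite -cards_eq0; move: cX;
  rewrite (leqNgt k) k2 leqn0. Qed.

Lemma adj_neq u v : e u v -> u != v.
Proof. by move=> euv; apply: contraTneq euv => ->; rewrite e_irr. Qed.

Lemma inner_mem x y v : v \in V -> v != x -> v != y -> v \in V :\: [set x; y].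
Proof. by move=> vV vx vy; rewrite !inE negb_or vx vy. Qed.

Lemma three_connected x y D A z : reduced x y -> D != set0 ->
  D \subset V :\: [set x; y] ->
  z \in V :\: [set x; y] -> z \notin D -> ~~ (D \subset X) ->
  bd e V D \subset A -> 2 < #|A|.
Proof.
move=> c D0 sD zV zD DX sA; apply: leq_trans (subset_leq_card sA).
apply: (reduced_three c) => //.
by apply: contra zD => /subsetP; apply.
Qed.

Lemma card2_le (a b : T) : #|[set a; b]| <= 2.
Proof. by rewrite cards2; case: (_ != _). Qed.

Lemma card_setU1_gt n A c : n.+1 < #|A :|: [set c]| -> n < #|A|.
Proof.
by move=> lt_n; have := leq_trans lt_n (leq_card_setU _ _);
  rewrite cards1 addn1.
Qed.

Lemma nb_split1 A c v : N v \subset A :|: [set c] -> #|N v| <= #|nb e A v|.+1.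
Proof.
move=> sA; apply: leq_trans (nb_card_split sA) _; rewrite -addn1 leq_add2l.
by rewrite -(cards1 c); apply/subset_leq_card/subsetP=> z;
  rewrite !inE => /andP[].
Qed.

Definition in_triangle x := [exists a in N x, [exists b in N x, e a b]].

Lemma not_triangle_adj x a b : ~~ in_triangle x -> a \in N x -> b \in N x ->
  e a b = false.
Proof. by move=> /exists_inPn h /h /exists_inPn h' /h' /negPf. Qed.

(** A 4-cycle through [x] in which the vertex opposite to [x] is not [y]. *)
Definition in_square x y := [exists v in V :\: [set x; y], 1 < #|N v :&: N x|].

Lemma nby_neq x y b : reduced x y -> b \in N y -> [/\ b \in V, e y b,
  b != x & b != y].
Proof.
move=> c; rewrite in_nb => /andP[bV eyb]; split=> //;
  last by rewrite eq_sym adj_neq.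
by apply: contraTneq eyb => ->; rewrite e_sym (reduced_nadj c).
Qed.

(** Otherwise [x] and [m] separate the other inner vertices from [y]. *)
Lemma neighbour_neq x y m : reduced x y -> m \in V :\: [set x; y] ->
  ~~ (V :\: [set x; y] :\ m \subset X) -> exists2 b, b \in N y & b != m.
Proof.
move=> c mV DX; case: (boolP [exists b in N y, b != m]) =>
  [/exists_inP// | /exists_inPn no].
suff : 2 < #|[set x; m]| by rewrite ltnNge card2_le.
apply: (three_connected c _ _ mV _ DX).
- by apply: contraNneq DX => ->; rewrite sub0set.
- exact: subD1set.
- by rewrite !inE eqxx.
apply/subsetP=> w /bdP[wV wD [v vD evw]].
rewrite !inE; move: wD; rewrite !inE wV andbT negb_and negbK => /orP[-> | ];
  first by rewrite orbT.
rewrite negbK => /orP[-> // | /eqP wy].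
have /no : v \in N y.
  by rewrite in_nb e_sym -wy evw andbT; move: vD; rewrite !inE => /and3P[].
by rewrite negbK => /eqP vm; move: vD; rewrite !inE vm eqxx.
Qed.

(** A path from [y] that avoids [x] first meets the edge [ab] in one end [d]; from there [x] is
    reached directly or through the other end [o]. *)
Lemma two_paths_triangle x y : reduced x y -> k = 2 -> in_triangle x ->
  admissible_paths e V x y k.
Proof.
move=> c kE /exists_inP[a ax /exists_inP[b bx eab]].
have [aV exa aney anex] := nby_neq (reduced_sym c) ax.
have [bV exb bney bnex] := nby_neq (reduced_sym c) bx.
have [r [n [rxy rx pr]]] := rooted_reach e_sym (reduced_rooted c) aV anex.
move: rxy; rewrite in_set2 (negPf rx) /= => /eqP rE; subst r.
have [||z [d [m [pz ezd]]]] := @pathl_exit _ e _ [set a;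
  b] _ _ _ (pathl_rev e_sym pr).
- by rewrite !inE negb_or eq_sym aney eq_sym.
- by rewrite set21.
rewrite inE in_set2 => /andP[dab _].
have [o [oab exd exo eod] [dV oV]] : exists2 o, [/\ (o \in [set a;
  b]) && (o != d),
    e x d, e x o & e o d] & d \in V /\ o \in V.
  have eba : e b a by rewrite e_sym.
  by case/orP: dab => /eqP->; [exists b | exists a];
    rewrite // !inE eqxx ?orbT /=; split; rewrite // adj_neq.
have xo := adj_neq exo.
case/andP: oab => oab ond; set Q := V :\ x :\: [set a; b] in pz.
have dQ : d \notin Q by rewrite in_setD in_set2 dab.
have oQ : o \notin Q by rewrite in_setD oab.
have xQ : x \notin Q by rewrite !inE eqxx andbF.
have edz : e d z by rewrite e_sym.
have p1 := pathl_cons edz dQ (pathl_rev e_sym pz).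
have x1 : x \notin d |: Q by rewrite in_setU1 negb_or xQ andbT adj_neq.
have o1 : o \notin d |: Q by rewrite in_setU1 negb_or oQ andbT.
have x2 : x \notin o |: (d |: Q) by rewrite in_setU1 negb_or x1 xo.
have p2 := pathl_cons exd x1 p1.
have p3 := pathl_cons exo x2 (pathl_cons eod o1 p1).
have sV : x |: (o |: (d |: Q)) \subset V.
  by rewrite !subUset !sub1set (reduced_x c) oV dV /= /Q; apply/subsetP=> t;
    rewrite !inE => /and3P[].
exists m.+2, 1; split; first by left.
rewrite kE => -[|[|i]] // _; split=> //.
  rewrite muln0 addn0; apply: pathl_sub p2; apply: subset_trans sV.
  by apply: setUS; apply: subsetUr.
by rewrite muln1 addn1; apply: pathl_sub p3.
Qed.

(** Similar to the triangle, but the detour from [x] to [d] runs through [o] and [v] and adds 2 to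
    the length. The path from [y] has to avoid both [x] and [v]; it is aimed at a non-exceptional
    [a'] so that [reduced_three] applies to the component of [a']. *)
Lemma two_paths_square x y : reduced x y -> k = 2 -> in_square x y ->
  admissible_paths e V x y k.
Proof.
move=> c kE /exists_inP[v vV /card_gt1P[a [b [ab_a ab_b ab]]]].
move: (vV); rewrite !inE negb_or => /andP[/andP[vx vy] vV'].
move: ab_a ab_b; rewrite !in_setI => /andP[av ax] /andP[bv bx].
have [aV exa aney anex] := nby_neq (reduced_sym c) ax.
have [bV exb bney bnex] := nby_neq (reduced_sym c) bx.
move: av bv; rewrite !in_nb => /andP[_ eva] /andP[_ evb].
have [a' a'ab a'X] : exists2 a', a' \in [set a; b] & a' \notin X.
  have [aX | aX] := boolP (a \in X); last by exists a; rewrite ?set21.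
  exists b; first exact: set22; apply/negP=> bX.
  have : #|[set a; b]| <= #|X| by apply: subset_leq_card;
    rewrite subUset !sub1set aX.
  by rewrite cards2 ab => h2; have := leq_trans h2 cX; rewrite kE.
have [a'V a'W] : a' \in V /\ a' \in V :\: [set x; v].
  rewrite inE in_set2; case/set2P: a'ab => ->;
    rewrite ?aV ?bV ?(negPf anex) ?(negPf bnex) /=;
    by rewrite eq_sym adj_neq.
have a'y : a' != y by case/set2P: a'ab => ->.
have sC := subsetP (comp_sub e a'W).
have [yC | yC] := boolP (y \in component e (V :\: [set x; v]) a'); last first.
  suff : 2 < #|[set x; v]| by rewrite ltnNge card2_le.
  apply: (three_connected (D := component e (V :\: [set x; v]) a') c _ _ vV).
  - by apply/set0Pn; exists a'; apply: comp_refl.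
  - apply/subsetP=> z zC; move: (sC z zC);
    rewrite !inE !negb_or => /andP[/andP[-> _] ->].
    by rewrite !andbT; apply: contraNneq yC => <-.
  - by apply/negP=> /sC; rewrite !inE eqxx orbT.
  - by apply/negP=> /subsetP sX; rewrite sX ?comp_refl in a'X.
  apply/subsetP=> w /bdP[wV wC [u uC euw]]; apply: contraNT wC => wxv.
  by apply: comp_closed uC _ euw => //; rewrite inE wxv.
have [n pr] := conn_path (comp_conn e_sym a'W) yC (comp_refl _ _ _).
have {}pr := pathl_sub (comp_sub e a'W) pr.
have [|| z [d [m [pz ezd]]]] := @pathl_exit _ e _ [set a; b] _ _ _ pr.
- by rewrite !inE negb_or eq_sym aney eq_sym.
- by [].
rewrite inE in_set2 => /andP[dab _].
have [o [oab exd exo evd evo] [dV oV]] : exists2 o, [/\ (o \in [set a;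
  b]) && (o != d),
    e x d, e x o, e v d & e v o] & d \in V /\ o \in V.
  case/orP: dab => /eqP->; [exists b | exists a];
    rewrite // !inE eqxx ?orbT ?ab //.
  by rewrite eq_sym ab.
case/andP: oab => oab ond; set Q := V :\: [set x; v] :\: [set a; b] in pz.
have dQ : d \notin Q by rewrite in_setD in_set2 dab.
have oQ : o \notin Q by rewrite in_setD oab.
have xQ : x \notin Q by rewrite !inE eqxx andbF.
have vQ : v \notin Q by rewrite !inE eqxx orbT andbF.
have edz : e d z by rewrite e_sym.
have p1 := pathl_cons edz dQ (pathl_rev e_sym pz).
have x1 : x \notin d |: Q by rewrite in_setU1 negb_or xQ andbT adj_neq.
have v1 : v \notin d |: Q by rewrite in_setU1 negb_or vQ andbT adj_neq.
have o2 : o \notin v |: (d |: Q).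
  by rewrite !in_setU1 !negb_or oQ ond !andbT eq_sym adj_neq.
have x2 : x \notin o |: (v |: (d |: Q)).
  by rewrite 2!in_setU1 !negb_or x1 !andbT adj_neq //= eq_sym.
have p2 := pathl_cons exd x1 p1.
have eov : e o v by rewrite e_sym.
have p3 := pathl_cons exo x2 (pathl_cons eov o2 (pathl_cons evd v1 p1)).
have sV : x |: (o |: (v |: (d |: Q))) \subset V.
  rewrite !subUset !sub1set (reduced_x c) oV dV vV' /= /Q.
  by apply/subsetP=> t; rewrite !inE => /and3P[].
exists m.+2, 2; split; first by right.
rewrite kE => -[|[|i]] // _; split=> //.
  rewrite muln0 addn0; apply: pathl_sub p2; apply: subset_trans sV.
  by apply: setUS; rewrite setUA; apply: subsetUr.
by rewrite muln1 addn2; apply: pathl_sub p3.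
Qed.

(* The rest of the graph is 2-connected with p and y joined because D can be
   chosen maximal; c is the exceptional vertex there. *)
Lemma three_separation x y p c D0 w1 w2 : reduced x y -> 2 < k ->
    p \in V :\: [set x; y] ->
    w1 \in N p :\: [set x; y] -> w2 \in N p :\: [set x; y] -> w1 != w2 ->
    D0 != set0 -> D0 \subset V :\: [set x; y; p] :\: [set w1; w2] ->
    bd e V D0 \subset [set x; p; c] ->
  admissible_paths e V x y k.
Proof.
move=> cxy k2 pV w1p w2p w12 D00 sD0 bdD0; have X0 := X_eq0 k2.
(* The third boundary vertex is left free, since it changes as [D] grows. Keeping [w1] and [w2]
   outside ensures that the other side has an inner vertex different from that vertex. *)
pose ok D := [&& D != set0, D \subset V :\: [set x; y; p] :\: [set w1; w2]
  & #|bd e V D :\: [set x; p]| <= 1].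
have ok0 : ok D0.
  apply/and3P; split=> //; rewrite -(cards1 c);
    apply/subset_leq_card/subsetP=> w.
  by rewrite in_setD => /andP[wxp /(subsetP bdD0)]; rewrite in_setU (negPf wxp).
case: (arg_maxnP (fun D => #|D|) ok0) =>
  D /and3P[Dn0 sD bdD] maxD {D0 D00 sD0 bdD0 ok0 c}.
have sDxy : D \subset V :\: [set x; y].
  apply/subsetP=> z /(subsetP sD); rewrite !inE !negb_or -!andbA.
  by case/andP=> _ /and5P[_ -> -> _ ->].
have notD z : z \in [set x; y; p] -> z \notin D.
  by move=> zz; apply/negP=> /(subsetP sD); rewrite inE in_setD zz andbF.
have xD : x \notin D by rewrite notD // !inE eqxx.
have yD : y \notin D by rewrite notD // !inE eqxx orbT.
have pD : p \notin D by rewrite notD // !inE eqxx orbT.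
have nX (A : {set T}) : A != set0 -> ~~ (A \subset X) by rewrite X0 subset0.
have [c cD] : exists c, c \in bd e V D :\: [set x; p].
  apply/set0Pn; apply/eqP=> b0; suff : 2 < #|[set x;
    p]| by rewrite ltnNge card2_le.
  apply: (three_connected cxy Dn0 sDxy pV pD (nX _ Dn0)).
  by rewrite -setD_eq0 b0.
move: (cD); rewrite in_setD in_set2 negb_or => /andP[/andP[cx cp] cb].
have bdc z : z \in bd e V D -> z \in [set x; p; c].
  move=> zb; rewrite in_setU; have [//|zxp] := boolP (z \in [set x; p]).
  by move/card_le1P: bdD => /(_ c cD z);
    rewrite in_setD zxp zb inE => /esym/eqP->; rewrite eqxx ?orbT.
have [cV cnD _] := (elimT (bdP _ _ _ _) cb).
move: (pV); rewrite in_setD in_set2 negb_or => /andP[/andP[px py] pV'].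
(* Vertices of [D] lose at most the neighbour [c], which costs one path. *)
have AP_xp : progression k.-1 (fun n => 2 <= n /\ pathl e (D :|: [set x;
  p]) x p n).
  have inn : (D :|: [set x; p]) :\: [set x; p] = D.
    apply/setP=> z; rewrite !inE negb_or; case: (boolP (z \in D)) => [zD|_] /=.
      by rewrite andbT; apply/andP; split;
        [apply: contraTneq zD | apply: contraTneq zD] => ->.
    by rewrite -negb_or andNb.
  apply: (IH (X' := set0)).
    apply/proper_card/properP; split; last first.
      by exists y; rewrite ?(reduced_y cxy) // !inE (negPf yD) eq_sym (negPf
        (reduced_neq cxy)) eq_sym.
    rewrite subUset (subset_trans sDxy (subsetDl _ _)) subUset !sub1set
      (reduced_x cxy).
    by rewrite pV'.
  have nbD v : v \in D -> N v \subset (D :|: [set x; p]) :|: [set c].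
    move=> vD; apply/subsetP=> w; rewrite in_nb => /andP[wV evw].
    rewrite -setUA inE; case: (boolP (w \in D)) => //= wD.
    by apply: bdc; apply/bdP; split=> //; exists v.
  split=> //; rewrite ?inn ?cards0 ?subset0 //.
  - by rewrite !inE eqxx orbT.
  - by rewrite !inE eqxx !orbT.
  - by rewrite eq_sym.
  - move=> D' D'0; rewrite inn => sD'.
    apply: (@card_setU1_gt _ _ c).
    apply: (three_connected cxy D'0 (subset_trans sD' sDxy) pV _ (nX _ D'0)).
      by apply: contra pD; apply: (subsetP sD').
    apply/subsetP=> w /bdP[wV wD' [v vD' evw]]; rewrite in_setU.
    have := subsetP (nbD v (subsetP sD' v vD')) w;
      rewrite in_nb wV evw => /(_ isT).
    rewrite in_setU => /orP[wW | ->]; last by rewrite orbT.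
    by apply/orP; left; apply/bdP; split=> //; exists v.
  move=> v vD _ _; have := reduced_deg cxy (subsetP sDxy v vD);
    rewrite X0 inE => /(_ isT).
  by move/leq_trans/(_ (nb_split1 (nbD v vD))); case: (k) k2.
(* On this side only [p] and [c] can have neighbours in [D]; every other inner vertex loses at most
   [x]. *)
have AP_py : progression 2 (fun n => 2 <= n /\ pathl e (V :\: D :\ x) p y n).
  apply: (IH (X' := [set c])).
    apply/proper_card/properP; split; first by apply/subsetP=> z;
      rewrite !inE => /and3P[].
    by exists x; rewrite ?(reduced_x cxy) // !inE eqxx.
  have inV2 z : (z \in V :\: D :\ x :\: [set p; y]) =
      [&& z \notin D, z != x, z != p, z != y & z \in V].
    by rewrite !inE negb_or; do !case: (_ == _); rewrite ?andbF //=.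
  split=> //; rewrite ?cards1 //.
  - by rewrite !inE px pD.
  - by rewrite !inE eq_sym (reduced_neq cxy) yD (reduced_y cxy).
  - move=> D' D'0 sD'; rewrite ltnNge; apply/negP=> le1.
    have sD'xy : D' \subset V :\: [set x; y].
      apply/subsetP=> z /(subsetP sD'); rewrite inV2 !inE negb_or.
      by case/and5P=> _ -> _ -> ->.
    have pD' : p \notin D' by apply/negP=> /(subsetP sD');
      rewrite inV2 eqxx !andbF.
    have xD' : x \notin D' by apply/negP=> /(subsetP sD');
      rewrite inV2 eqxx !andbF.
    (* If [c] is outside [D'], then [D'] does not see [D], and [x] is the only boundary vertex that
       was removed. If [c] is in [D'], the union of [D] and [D'] contradicts the choice of [D]. *)
    pose B := bd e (V :\: D :\ x) D'.
    have [cD' | cD'] := boolP (c \in D'); last first.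
      suff /card_setU1_gt : 2 < #|B :|: [set x]| by rewrite ltnNge le1.
      apply: (three_connected cxy D'0 sD'xy pV pD' (nX _ D'0)).
      apply/subsetP=> w /bdP[wV wD' [v vD' evw]]; rewrite !inE orbC.
      case: eqVneq => //= wx; apply/andP; split; last by apply/exists_inP;
        exists v.
      rewrite wD' wV andbT; apply/negP=> wD.
      have vB : v \in bd e V D.
        have := subsetP sD' v vD'; rewrite inV2 => /and5P[vD _ _ _ vV].
        by apply/bdP; split=> //; exists w; rewrite // e_sym.
      move: (bdc v vB); rewrite !inE => /orP[/orP[]|] /eqP vE; subst v.
      + by rewrite vD' in xD'.
      + by rewrite vD' in pD'.
      by rewrite vD' in cD'.
    have sbd z : z \in bd e V (D :|: D') -> z \in [set x; p] :|: B.
      case/bdP=> zV; rewrite !inE negb_or => /andP[zD zD'] [v vDD evz].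
      case: eqVneq => //= zx; case: eqVneq => //= zp.
      rewrite zD' zD zV /=; case/setUP: vDD => [vD | vD'];
        last by apply/exists_inP; exists v.
      have : z \in bd e V D by apply/bdP; split=> //; exists v.
      move/bdc; rewrite !inE (negPf zx) (negPf zp) /= => /eqP zc.
      by rewrite zc cD' in zD'.
    (* If [D'] contained a neighbour of [p], its only boundary vertex would be [p], and [x] and [p]
       would cut off the union of [D] and [D']. *)
    have wD' w : w \in N p :\: [set x; y] -> w \notin D'.
      move=> wp; apply/negP=> wD'.
      have epw : e p w by move: wp; rewrite !inE => /andP[_ /andP[]].
      have pB : p \in B by apply/bdP; split; rewrite ?inE ?px ?pD //;
        exists w; rewrite // e_sym.
      have BE : B \subset [set p].
        have /eqP-> // : [set p] == B by rewrite eqEcard sub1set pB cards1.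
      have DD0 : D :|: D' != set0.
        by case/set0Pn: Dn0 => z zD; apply/set0Pn; exists z; rewrite inE zD.
      suff : 2 < #|[set x; p]| by rewrite ltnNge card2_le.
      apply: (three_connected cxy DD0 _ pV _ (nX _ DD0)).
      - by rewrite subUset sDxy.
      - by rewrite inE negb_or pD.
      apply/subsetP=> z /sbd; rewrite inE => /orP[// | /(subsetP BE)].
      by rewrite !inE => ->; rewrite orbT.
    have : ok (D :|: D').
      apply/and3P; split.
      - by case/set0Pn: Dn0 => z zD; apply/set0Pn; exists z; rewrite inE zD.
      - rewrite subUset sD; apply/subsetP=> z zD'.
        rewrite inE in_set2 negb_or -andbA; apply/and3P; split.
        + by apply: contraTneq zD' => ->; apply: wD'.
        + by apply: contraTneq zD' => ->; apply: wD'.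
        have := subsetP sD' z zD'; rewrite inV2 !inE !negb_or.
        by case/and5P=> _ -> -> -> ->.
      apply: leq_trans le1; apply/subset_leq_card/subsetP=> z.
      by rewrite in_setD => /andP[zxp /sbd]; rewrite inE (negPf zxp).
    move/maxD; apply/negP; rewrite -ltnNge; apply/proper_card/properP.
    by split; [apply: subsetUl | exists c; rewrite // inE cD' orbT].
  - have [w wp wc] : exists2 w, w \in N p :\: [set x; y] & w != c /\ w \notin D.
      have wD w : w \in [set w1; w2] -> w \notin D.
        by move=> ww; apply/negP=> /(subsetP sD); rewrite in_setD ww.
      have [w1c | w1c] := eqVneq w1 c; last by exists w1; rewrite // wD ?set21.
      by exists w2; rewrite // wD ?set22 // -w1c eq_sym.
    apply/negP=> /subsetP/(_ w); rewrite inV2 inE (negPf wc.1) wc.2.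
    move: wp; rewrite inE in_set2 negb_or in_nb =>
      /andP[/andP[-> ->] /andP[-> epw]].
    by rewrite eq_sym adj_neq //= => /(_ isT).
  move=> v; rewrite inV2 inE => /and5P[vD vx vp vy vV] vc _.
  have := reduced_deg cxy (inner_mem vV vx vy); rewrite X0 inE => /(_ isT).
  suff : N v \subset (V :\: D :\ x) :|: [set x].
    by move/nb_split1=> le_k /leq_trans/(_ le_k); rewrite ltnS;
      apply: leq_trans.
  apply/subsetP=> w; rewrite in_nb !inE orbC => /andP[wV evw].
    case: eqVneq => //= wx; rewrite wV andbT; apply/negP=> wD.
    have : v \in bd e V D by apply/bdP; split=> //; exists w; rewrite // e_sym.
    by move/bdc; rewrite !inE (negPf vx) (negPf vp) (negPf vc).
have k0 : 0 < k.-1 by case: (k) k2 => [|[]].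
rewrite /admissible_paths;
  apply: (@progression_add k.-1 2 k _ _ _ k0 isT _ _ AP_xp AP_py);
    first by case: (k) k2 => // l _; rewrite addn2.
move=> m n [m2 pm] [n2 pn]; split; first by rewrite (leq_trans m2) ?leq_addr.
apply: pathl_sub (pathl_cat _ pm pn).
  rewrite !subUset !sub1set (reduced_x cxy) pV' (subset_trans sDxy (subsetDl _
    _)) /=.
  by apply/subsetP=> z; rewrite !inE => /and3P[].
move=> z; rewrite !inE => /orP[-> | /orP[/eqP-> | /eqP-> //]];
  first by rewrite andbF.
by rewrite eqxx.
Qed.

End Reductions.

(* Deleting and contracting lowers degrees by at most l; since one path always
   exists, [maxn 1 (k - l)] of them remain. *)
Lemma loss_deg k a b h l : k < a + b -> b <= h + l -> 1 < maxn 1 (k - l) ->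
  maxn 1 (k - l) < a + h.
Proof. lia. Qed.

Lemma loss_sum k s l : l < s -> k < s + maxn 1 (k - l).
Proof. lia. Qed.

Lemma loss_bool k l : 1 < k -> (k <= 2) <= (maxn 1 (k - l) <= 2).
Proof. lia. Qed.

(** * Cliques *)

Section Structures.
Variables (T : finType) (e : rel T) (V X : {set T}) (k : nat).
Hypotheses (e_sym : symmetric e) (e_irr : irreflexive e).
Hypothesis IH : forall e' (V' : {set T}) x' y' k' X', #|V'| < #|V| ->
  rooted_graph e' V' x' y' k' X' -> admissible_paths e' V' x' y' k'.
Hypotheses (k_gt1 : 1 < k) (cX : #|X| <= (k <= 2)).
Implicit Types (A B C D H K S U W Q : {set T}) (x y r u v w : T).

Notation N := (nb e V).
Notation reduced := (reduced e V X k).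
Notation in_triangle := (in_triangle e V).
Notation bad_piece := (bad_piece e V).
Notation admissible x y := (admissible_paths e V x y k).

(** Here [l] bounds the degree lost in passing to the contracted graph, with one neighbour regained
    as the new root. The number of paths drops by at most [l], and the [s > l] lengths inside [H]
    make up for it. *)
Lemma contraction_admissible x y W H U r m s l (C := component e (W :\: H) r) :
    reduced x y -> W \subset V -> H \subset W -> U \subset H -> x \in H ->
    x \notin U -> U != set0 -> r \in W -> r \notin H ->
    pathl e (r |: (V :\: W)) r y m ->
    (forall v, v \in C :\ r -> N v \subset W) -> ~~ (C :\ r \subset X) ->
    y \notin C :\ r -> l < s ->
    (forall v, v \in C :\ r -> v \notin X -> #|nb e H v| <= hit e U v + l) ->
    progression s (fun n => {in U, forall u, pathl e H x u n}) ->
  (exists D c, bad_piece C r (H :\: U) D c) \/ admissible x y.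
Proof.
move=> c sWV sHW sUH xH xU U0 rW rH tail nbW CX yC ls loss APs.
have rWH : r \in W :\: H by rewrite inE rH.
have sC := subsetP (comp_sub e rWH).
have [|v vC vX sN k1 | |APt] :=
  @contraction_component _ e V e_sym e_irr IH W H U x r (maxn 1 (k - l)) X
    sWV sHW sUH xH xU U0 rW rH nbW _ CX.
- exact: leq_trans cX (loss_bool l k_gt1).
- move: vC; rewrite -/C => vC; apply: loss_deg (loss v vC vX) k1.
  have vN : v \in V :\: [set x; y].
    move: (vC); rewrite in_setD1 => /andP[vr /sC];
      rewrite in_setD => /andP[vH vW].
    apply: inner_mem; first exact: (subsetP sWV).
      by apply: contraNneq vH => ->.
    by apply: contraNneq yC => <-.
  by apply: leq_trans (reduced_deg c vN vX) (nb_card_split sN).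
- by left.
right; apply: (combine _ _ (loss_sum k ls) APs APt _ tail).
- by apply: leq_ltn_trans ls.
- by rewrite leq_max.
- by apply/pred0P=> z /=; apply/negP=> /andP[zH /sC]; rewrite in_setD zH.
- move=> z; rewrite !in_setU in_set1 in_setD =>
  /orP[zH | zC] /orP[/eqP // | /andP[zW _]].
    by rewrite (subsetP sHW) in zW.
  by move/sC: zC; rewrite in_setD (negPf zW) andbF.
rewrite !subUset (subset_trans sHW sWV) sub1set (subsetP sWV _ rW) subsetDl
  !andbT.
by apply/subsetP=> z /sC; rewrite in_setD => /andP[_ /(subsetP sWV)].
Qed.

(** The vertices of [D] see only [D], [b] and [H :\: U], and [U1] covers the last set up to [x]. So
    a subset of [D] not seen by [U1] can lose no boundary vertex but [x], and three boundary
    vertices leave two. The paths found end in [b] and continue to [r] outside [D]. *)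
Lemma bad_piece_admissible x y W H U U1 r m s l D b (C :=
  component e (W :\: H) r) :
    reduced x y -> 2 < k -> W \subset V -> H \subset W -> x \in H ->
      y \notin H ->
    r \in W -> r \notin H -> pathl e (r |: (V :\: W)) r y m ->
    y \notin C :\ r -> bad_piece C r (H :\: U) D b ->
    U1 \subset H -> x \notin U1 -> U1 != set0 -> H :\: U \subset x |: U1 ->
    l < s -> {in D, forall v, #|nb e (x |: U1) v| <= hit e U1 v + l} ->
    progression s (fun n => {in U1, forall u, pathl e H x u n}) ->
  admissible x y.
Proof.
move=> c k2 sWV sHW xH yH rW rH tail yC /and5P[D0 sD bC bdC bdV] sU1 xU1 U10 HU
  ls loss APs.
have rWH : r \in W :\: H by rewrite inE rH.
have sC := subsetP (comp_sub e rWH); have conC := comp_conn e_sym rWH.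
have CW z : z \in C -> z \in W by move=> /sC; rewrite inE => /andP[].
have CH z : z \in C -> z \notin H by move=> /sC; rewrite inE => /andP[].
have DC z : z \in D -> z \in C by move=> /(subsetP sD); rewrite inE => /andP[].
have rD : r \notin D by apply/negP=> /(subsetP sD); rewrite !inE eqxx.
have sDxy : D \subset V :\: [set x; y].
  apply/subsetP=> z zD; apply: inner_mem;
    first exact: (subsetP sWV _ (CW z (DC z zD))).
    by apply: contraTneq (DC z zD) => ->; apply/negP=> /CH; rewrite xH.
  by apply: contraTneq zD => ->; apply: contra yC; apply: (subsetP sD).
have bDC z : z \in b |: D -> z \in C by rewrite in_setU1 =>
  /orP[/eqP-> // | /DC].
have bD : b \notin D.
  have /set0Pn[z zb] : bd e C D != set0.
    by apply: (conn_bd e_sym conC _ D0 (comp_refl _ _ _) rD); apply/subsetP.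
  move: (subsetP bdC z zb); rewrite in_set1 => /eqP <-.
  by case/bdP: zb.
have bDb : (b |: D) :\ b = D by rewrite setU1K.
have HC z : z \in H -> z \in C -> False by move=> zH /CH; rewrite zH.
have nbD v w : v \in D -> w \in V -> e v w -> w \notin D ->
  w \in b |: (x |: U1).
  move=> vD wV evw wD; have : w \in bd e V D by apply/bdP; split=> //; exists v.
  move/(subsetP bdV); rewrite !in_setU1 => /orP[-> // | /(subsetP HU)].
  by rewrite in_setU1 => ->; rewrite orbT.
have X0 := X_eq0 cX k2.
have [u uU1] := set0Pn _ U10.
have uV : u \in V :\: [set x; y].
  have uH := subsetP sU1 u uU1; apply: inner_mem.
  - exact: (subsetP sWV _ (subsetP sHW _ uH)).
  - by apply: contraNneq xU1 => <-.
  by apply: contraNneq yH => <-.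
have APt : progression (maxn 1 (k - l))
    (fun n => 2 <= n /\ exists2 u, u \in U1 & pathl e (u |: (b |: D)) u b n).
  apply: (@contraction _ e V e_sym e_irr IH (b |: D) U1 x b _ set0);
    rewrite ?bDb //.
  - exact: (reduced_x c).
  - by apply/negP=> /bDC/CH; rewrite xH.
  - by apply/subsetP=> z /bDC/CW/(subsetP sWV).
  - exact: setU11.
  - exact: subset_trans sU1 (subset_trans sHW sWV).
  - by apply/pred0P=> z /=; apply/negP=> /andP[/(subsetP sU1) zH /bDC];
    apply: HC.
  - move=> D' D'0 sD'; have /set0Pn[w /bdP[wC wD' [v vD' evw]]] :
    bd e C D' != set0.
      apply: (conn_bd e_sym conC _ D'0 (comp_refl _ _ _)).
        by apply/subsetP=> z /(subsetP sD')/DC.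
      by apply: contra rD; apply: (subsetP sD').
    apply/set0Pn; exists w; apply/bdP; split=> //; last by exists v.
    rewrite in_setU1 orbC; case: (boolP (w \in D)) => //= wD.
    have : w \in bd e C D by apply/bdP; split=> //; exists v;
      rewrite // (subsetP sD').
    by move/(subsetP bdC); rewrite in_set1.
  - move=> D' D'0 sD' noh; apply: (@card_setU1_gt _ _ _ x).
    apply: (three_connected c D'0 (subset_trans sD' sDxy) uV).
    + apply/negP=> /(subsetP sD')/DC; apply: HC; exact: (subsetP sU1).
    + by rewrite X0 subset0.
    apply/subsetP=> w /bdP[wV wD' [v vD' evw]]; rewrite in_setU in_set1 orbC.
    case: eqVneq => //= wx; apply/bdP; split=> //; last by exists v.
    rewrite in_setU1 orbC; case: (boolP (w \in D)) => //= wD.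
    have := nbD v w (subsetP sD' v vD') wV evw wD.
    rewrite !in_setU1 (negPf wx) /= => /orP[// | wU].
    by case/negP: (noh v vD'); apply/hitP; exists w; rewrite // e_sym.
  - by rewrite cards0.
  - by rewrite subset0.
  move=> v vD _ k1; apply: loss_deg (loss v vD) k1.
  have := reduced_deg c (subsetP sDxy v vD); rewrite X0 inE => /(_ isT).
  move=> lt_k; apply: leq_trans lt_k (nb_card_split _).
  apply/subsetP=> w; rewrite in_nb => /andP[wV evw]; rewrite in_setU in_setU1.
  case: (boolP (w \in D)) => [_ | wD]; first by rewrite orbT.
  by have := nbD v w vD wV evw wD; rewrite in_setU1 => /orP[->|->];
    rewrite ?orbT.
have sDC : D \subset C by apply/subsetP=> z /DC.
have [m' pbr] := conn_path_avoid e_sym conC sDC D0 (comp_refl _ _ _) rD bdC.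
have pby : pathl e ((C :\: D) :|: (r |: (V :\: W))) b y (m' + m).
  apply: pathl_cat pbr tail => z; rewrite in_setD => /andP[_ /CW zW].
  by rewrite in_setU1 in_setD zW orbF => /eqP.
apply: (combine _ _ (loss_sum k ls) APs APt _ pby).
- by apply: leq_ltn_trans ls.
- by rewrite leq_max.
- by apply/pred0P=> z /=; apply/negP=> /andP[zH /bDC]; apply: HC.
- have bW z : z \in b |: D -> z \in W by move/bDC/CW.
  move=> z; rewrite in_setU => /orP[zH | zbD].
    rewrite !in_setU in_set1 !in_setD (subsetP sHW) //=.
    case/orP=> [/andP[_ /(HC z zH)] // | /orP[/eqP zr | //]].
    by rewrite -zr zH in rH.
  rewrite in_setU in_setU1 !in_setD (bW z zbD) /= orbF.
  move: zbD; rewrite in_setU1 => /orP[/eqP // | zD].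
  by rewrite zD /= => /eqP zr; rewrite -zr zD in rD.
rewrite !subUset (subset_trans sHW sWV) !sub1set (subsetP sWV _ rW) subsetDl.
rewrite (subsetP sWV _ (CW b bC)) (subset_trans sDxy (subsetDl _ _)) !andbT /=.
by apply/subsetP=> z; rewrite in_setD => /andP[_ /CW/(subsetP sWV)].
Qed.

Definition cliqueb K := [forall a in K, [forall b in K, (a != b) ==> e a b]].

Lemma cliqueP K : reflect (clique e K) (cliqueb K).
Proof.
apply: (iffP forall_inP) => [h a b aK bK | h a aK].
  exact/implyP/(forall_inP (h a aK)).
by apply/forall_inP=> b bK; apply/implyP; apply: h.
Qed.

Lemma clique_add K v : clique e K -> {in K, forall u, e u v} ->
  clique e (v |: K).
Proof.
move=> Kc Kv a b; rewrite !in_setU1 => /orP[/eqP->|aK] /orP[/eqP->|bK];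
  last exact: Kc.
- by rewrite eqxx.
- by move=> _; rewrite e_sym Kv.
by move=> _; apply: Kv.
Qed.

Lemma edge_not_clique K v : clique e K -> v \notin K ->
    ~~ cliqueb (v |: K) -> exists2 u, u \in K & ~~ e u v.
Proof.
move=> Kc vK nc; apply/exists_inP; apply: contraNT nc => /exists_inPn h.
by apply/cliqueP/clique_add => // u /h; rewrite negbK.
Qed.

(** The lengths inside the clique run from 1 to [#|K|.-1]. An outside vertex misses some vertex of
    [K], so it loses at most [#|K|.-2] if it sees an exit. If it sees only [x] it loses 1, which is
    within the bound as [2 < #|K|]. A bad piece would be cut off by [d] and [x]. *)
Lemma clique_admissible x y K b : reduced x y -> 2 < k -> x \in K ->
  K \subset V :\ y ->
    clique e K -> 2 < #|K| ->
    (forall v, v \in V -> v \notin K -> v != y -> exists2 u, u \in K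
      & ~~ e u v) ->
    b \in N y -> b \notin K ->
  admissible x y.
Proof.
move=> c k2 xK sK Kc cK maxK bN bK; have X0 := X_eq0 cX k2.
have yK : y \notin K by apply/negP=> /(subsetP sK); rewrite !inE eqxx.
have sKV : K \subset V := subset_trans sK (subsetDl _ _).
have cU : #|K :\ x| = #|K|.-1 by have := cardsD1 x K; rewrite xK => ->.
have [bV eyb bx byy] := nby_neq e_sym e_irr c bN.
have yW : y \in V :\: K by rewrite inE yK (reduced_y c).
have sC := subsetP (comp_sub e yW).
have U0 : K :\ x != set0 by rewrite -card_gt0 cU; case: (#|K|) cK => [|[]].
have xU : x \notin K :\ x by rewrite !inE eqxx.
have [| | | | | | | [D [d /and5P[D0 sD dC bdC bdV]]] | //] :=
  @contraction_admissible x y V K (K :\ x) y 0 #|K|.-1 #|K|.-2 c (subxx _) sKV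
    (subD1set _ _) xK xU U0
    (reduced_y c) yK.
- by apply: pathl_refl; rewrite setU11.
- by move=> v _; apply/subsetP=> w; rewrite in_nb => /andP[].
- rewrite X0 subset0; apply/set0Pn; exists b; rewrite in_setD1 byy.
  by apply: (comp_closed yW (comp_refl _ _ _) _ eyb); rewrite inE bK.
- by rewrite !inE eqxx.
- by case: (#|K|) cK => [|[]].
- move=> v; rewrite in_setD1 => /andP[vy /sC];
  rewrite in_setD => /andP[vK vV] _.
  case: (boolP (hit e (K :\ x) v)) => [hv | noh].
    have [u uK euv] := maxK v vV vK vy.
    have : nb e K v \subset K :\ u.
      apply/subsetP=> w; rewrite in_nb in_setD1 => /andP[-> evw]; rewrite andbT.
      by apply: contraNneq euv => <-; rewrite e_sym.
    move/subset_leq_card/leq_trans; apply.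
    by move: cK; rewrite (cardsD1 u K) uK; case: #|K :\ u|.
  have : nb e K v \subset [set x].
    apply/subsetP=> w; rewrite in_nb in_set1 => /andP[wK evw].
    by apply: contraNT noh => wx; apply/hitP; exists w;
      rewrite ?inE ?wx // e_sym.
  move/subset_leq_card/leq_trans; apply; rewrite cards1.
  by case: (#|K|) cK => [|[|[]]].
- exists 1, 1; split=> [|i i_lt u]; first by left.
  rewrite in_setD1 => /andP[ux uK]; rewrite mul1n add1n.
  apply: clique_path => //; first by rewrite eq_sym.
  by rewrite /=; case: (#|K|) cK i_lt.
have xbd : bd e V D \subset [set d; x].
  apply: subset_trans bdV _; apply/subsetP=> z; rewrite !inE.
  by case: (z == d) => //=; case: (z == x); case: (z \in K).
have [u uU] := set0Pn _ U0; move: (uU); rewrite in_setD1 => /andP[ux uK].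
have DC z : z \in D -> [/\ z \in V, z \notin K & z != y].
  by move/(subsetP sD); rewrite in_setD1 => /andP[-> /sC];
    rewrite in_setD => /andP[].
suff : 2 < #|[set d; x]| by rewrite ltnNge card2_le.
apply: (three_connected c D0 _ (z := u) _ _ _ xbd).
- apply/subsetP=> z /DC[zV zK zy]; apply: inner_mem => //.
  by apply: contraNneq zK => ->.
- apply: inner_mem ux _; first exact: (subsetP sKV).
  by apply: contraNneq yK => <-.
- by apply/negP=> /DC[_ /negP[]].
by rewrite X0 subset0.
Qed.

(** This is left over when the maximal cliques at both roots absorb the neighbours of the opposite
    root. A vertex [m0] of [M] is taken out of the clique to be the new root, its edge to [y] is the
    tail, and a component of the remaining graph is used instead of the component of [y]. *)
Lemma twin_clique_admissible x y M : reduced x y -> 2 < k -> N x = M ->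
  N y = M -> clique e M ->
  1 < #|M| -> admissible x y.
Proof.
move=> c k2 NxM NyM Mc cM; have X0 := X_eq0 cX k2.
have MV : M \subset V by rewrite -NxM; apply/subsetP=> z;
  rewrite in_nb => /andP[].
have xM : x \notin M by rewrite -NxM in_nb e_irr andbF.
have yM : y \notin M by rewrite -NyM in_nb e_irr andbF.
have eMx z : z \in M -> e z x by rewrite -NxM in_nb e_sym => /andP[].
have eMy z : z \in M -> e z y by rewrite -NyM in_nb e_sym => /andP[].
have xMc A : A \subset M -> clique e (x |: A).
  move=> sA; apply: clique_add (cliqueS sA Mc) _ => z /(subsetP sA); exact: eMx.
have nxy z : z \in M -> (x != z) * (z != y) * (x != y).
  move=> zM; rewrite (reduced_neq c); split=> //; split.
    by apply: contraNneq xM => ->.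
  by apply: contraNneq yM => <-.
have [R0 | R0] := boolP (V :\: M :\: [set x; y] == set0).
  (* There is nothing besides [x], [y] and [M]: the degree of [m] gives [k <= #|M|], and the clique
     has enough paths. *)
  have [m mM] : exists m, m \in M by apply/card_gt0P; apply: ltnW cM.
  have [[xm my] xy] := nxy m mM.
  have lt_k : k < #|M|.+1.
    have := reduced_deg c (inner_mem (subsetP MV m mM) _ my);
      rewrite eq_sym X0 inE.
    move=> /(_ xm isT) /leq_trans; apply.
    have : N m \subset x |: (y |: (M :\ m)).
      apply/subsetP=> z; rewrite in_nb => /andP[zV emz].
      move: R0; rewrite setD_eq0 => /subsetP/(_ z); rewrite !inE zV andbT.
      case: (z \in M) => /= [_|/(_ isT) /orP[->|->]]; rewrite ?orbT //.
      by rewrite [z == m]eq_sym (negPf (adj_neq e_irr emz)) !orbT.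
    move/subset_leq_card/leq_trans; apply.
    by rewrite !cardsU1 (cardsD1 m M) mM addnA -addSn leq_add2r;
      do 2!case: (_ \notin _).
  exists 2, 1; split=> [|i i_lt]; first by left.
  rewrite mul1n; split=> //.
  have : pathl e (x |: M) x m i.+1.
    apply: clique_path; rewrite ?setU11 //; first exact: xMc.
      by rewrite in_setU1 mM orbT.
    by rewrite cardsU1 xM /= add1n; apply: leq_trans i_lt _.
  move/(pathl_rev e_sym) => p.
  have yxM : y \notin x |: M by rewrite in_setU1 negb_or yM eq_sym xy.
  have eym : e y m by rewrite e_sym eMy.
  apply: (pathl_sub _ (pathl_rev e_sym (pathl_cons eym yxM p))).
  by rewrite !subUset !sub1set (reduced_x c) (reduced_y c).
have [v0 v0R] := set0Pn _ R0.
set Q := component e (V :\: M :\: [set x; y]) v0.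
have sQ := subsetP (comp_sub e v0R); have Qc := comp_conn e_sym v0R.
have QR z : z \in Q -> [/\ z \in V, z \notin M, z != x & z != y].
  by move/sQ; rewrite !inE negb_or => /andP[/andP[-> ->] /andP[-> ->]].
have nbQ v w : v \in Q -> w \in V -> e v w -> w \in Q :|: M.
  move=> vQ wV evw; have [vV vM vx vy] := QR v vQ.
  rewrite in_setU orbC; case: (boolP (w \in M)) => //= wM.
  apply: comp_closed vQ _ (evw) => //; rewrite !inE wM wV negb_or !andbT.
  apply/andP; split; apply: contraNneq vM => wE; subst w.
    by rewrite -NxM in_nb vV e_sym.
  by rewrite -NyM in_nb vV e_sym.
have Q0 : Q != set0 by apply/set0Pn; exists v0; apply: comp_refl.
have sQxy : Q \subset V :\: [set x; y].
  by apply/subsetP=> z /QR[zV _ zx zy]; apply: inner_mem.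
have /card_gt0P[m0 m0b] : 0 < #|bd e V Q| by apply: ltnW;
  apply: (reduced_rooted c).
have [m0V m0Q [q0 q0Q eq0]] := elimT (bdP _ _ _ _) m0b.
have m0M : m0 \in M by have := nbQ _ _ q0Q m0V eq0; rewrite in_setU (negPf m0Q).
have cU : #|M :\ m0| = #|M|.-1 by have := cardsD1 m0 M; rewrite m0M => ->.
have xU : x \notin M :\ m0 by rewrite in_setD1 negb_and xM orbT.
have Qm0 : (m0 |: Q) :\ m0 = Q by rewrite setU1K.
have UM z : z \in M :\ m0 -> z \in M by rewrite in_setD1 => /andP[].
have QM z : z \in M -> z \in Q -> False by move=> zM /QR[_ /negP].
have APt : progression (maxn 1 (k - #|M|.-2))
    (fun n => 2 <= n /\ exists2 u, u \in M :\ m0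
      & pathl e (u |: (m0 |: Q)) u m0 n).
  apply: (@contraction _ e V e_sym e_irr IH (m0 |: Q) (M :\ m0) x m0 _ set0);
    rewrite ?Qm0 //.
  - exact: (reduced_x c).
  - rewrite in_setU1 negb_or (nxy m0 m0M).1.1 /=.
    by apply/negP=> /QR[_ _]; rewrite eqxx.
  - by rewrite subUset sub1set m0V (subset_trans sQxy (subsetDl _ _)).
  - exact: setU11.
  - exact: subset_trans (subD1set _ _) MV.
  - apply/pred0P=> z /=; apply/negP=> /andP[]; rewrite /= in_setD1 in_setU1.
    by case/andP=> /negPf-> zM /=; apply: QM.
  - by rewrite -card_gt0 cU; case: (#|M|) cM => [|[]].
  - move=> D D0 sD; have [QD | ] := boolP (Q \subset D).
      apply/set0Pn; exists m0; apply/bdP; split; first exact: setU11.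
        by apply: contra m0Q; apply: (subsetP sD).
      by exists q0; rewrite ?(subsetP QD).
    case/subsetPn=> r rQ rD;
      have /set0Pn[w /bdP[wQ wD vw]] := conn_bd e_sym Qc sD D0 rQ rD.
    by apply/set0Pn; exists w; apply/bdP; split=> //; rewrite in_setU1 wQ orbT.
  - move=> D D0 sD noh;
    apply: leq_trans (reduced_rooted c D0 (subset_trans sD sQxy)) _.
    apply/subset_leq_card/subsetP=> w /bdP[wV wD [v vD evw]].
    apply/bdP; split=> //; last by exists v.
    have := nbQ v w (subsetP sD v vD) wV evw; rewrite in_setU in_setU1 orbC.
    case/orP=> [wM | ->]; last by rewrite orbT.
    case: eqVneq => //= wm0; case/negP: (noh v vD); apply/hitP; exists w.
      by rewrite in_setD1 wm0.
    by rewrite e_sym.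
  - by rewrite cards0.
  - by rewrite subset0.
  move=> v vQ _ k1; apply: (loss_deg (b := #|nb e (M :\ m0) v|)) k1.
    have := reduced_deg c (subsetP sQxy v vQ); rewrite X0 inE => /(_ isT).
    move=> lt_k; apply: leq_trans lt_k (nb_card_split _).
    apply/subsetP=> w; rewrite in_nb => /andP[wV evw].
    have := nbQ v w vQ wV evw; rewrite in_setU !inE => /orP[->|->];
      rewrite ?orbT //.
    by case: eqVneq; rewrite ?orbT.
  case: (boolP (hit e (M :\ m0) v)) => [_ | noh].
    have : nb e (M :\ m0) v \subset M :\ m0 by apply/subsetP=> w;
      rewrite in_nb => /andP[].
    by move/subset_leq_card/leq_trans; apply; rewrite cU;
      case: (#|M|) cM => [|[]].
  rewrite (_ : nb _ _ _ = set0) ?cards0 //; apply/setP=> w;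
    rewrite in_nb in_set0.
  apply: contraNF noh => /andP[wU evw]; apply/hitP; exists w => //.
  by rewrite e_sym.
have ls : #|M|.-2 < #|M|.-1 by case: (#|M|) cM => [|[]].
apply: (combine (s := #|M|.-1) (H := x |: (M :\ m0)) (Y := [set m0; y]) (m := 1)
  _ _ (loss_sum k ls) _ APt).
- by apply: leq_ltn_trans ls.
- by rewrite leq_max.
- exists 1, 1; split=> [|i i_lt u uU]; first by left.
  rewrite mul1n add1n; apply: clique_path; rewrite ?setU11 //.
  + by apply: xMc; apply: subD1set.
  + by rewrite in_setU1 uU orbT.
  + exact: (nxy u (UM u uU)).1.1.
  by rewrite cardsU1 xU cU /= add1n ltnS.
- apply/pred0P=> z /=; apply/negP=> /andP[]; rewrite /= !in_setU1 in_setD1.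
  case/orP=> [/eqP-> | /andP[/negPf-> zM]] /=.
    by rewrite (negPf (nxy m0 m0M).1.1) /= => /QR[_ _]; rewrite eqxx.
  exact: QM.
- apply: pathl_edge; rewrite ?set21 ?set22 //; first exact: eMy.
  exact: (nxy m0 m0M).1.2.
- move=> z zHC; rewrite in_set2 => /orP[/eqP // | /eqP zy]; subst z.
  move: zHC; rewrite !in_setU !in_set1 in_setD1 (negPf yM) andbF orbF.
  case/or3P=> [/eqP yx | /eqP // | /QR[_ _ _]]; last by rewrite eqxx.
  by have := reduced_neq c; rewrite yx eqxx.
rewrite !subUset !sub1set (reduced_x c) (reduced_y c) m0V (subset_trans sQxy
  (subsetDl _ _)).
by rewrite (subset_trans (subD1set _ _) MV).
Qed.

End Structures.

Section TrianglesAndDiamonds.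
Variables (T : finType) (e : rel T) (V X : {set T}) (k : nat).
Hypotheses (e_sym : symmetric e) (e_irr : irreflexive e).
Hypothesis IH : forall e' (V' : {set T}) x' y' k' X', #|V'| < #|V| ->
  rooted_graph e' V' x' y' k' X' -> admissible_paths e' V' x' y' k'.
Hypotheses (k_gt1 : 1 < k) (cX : #|X| <= (k <= 2)).
Implicit Types (A B C D H K S U W Q : {set T}) (x y r u v w : T).

Notation N := (nb e V).
Notation reduced := (reduced e V X k).
Notation in_triangle := (in_triangle e V).
Notation bad_piece := (bad_piece e V).
Notation cliqueb := (cliqueb e).
Notation admissible x y := (admissible_paths e V x y k).

Lemma in_triangleI x a b : a \in N x -> b \in N x -> e a b -> in_triangle x.
Proof.
by move=> ax bx eab; apply/exists_inP; exists a => //; apply/exists_inP;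
  exists b.
Qed.

Lemma two_neighbours x y a b : reduced x y -> 2 < k -> a \in V :\: [set x; y] ->
    b \in V :\: [set x; y] -> a != b ->
  exists b1 b2, [/\ b1 \in N y, b2 \in N y & b1 != b2].
Proof.
move=> c k2 aV bV ab; have X0 := X_eq0 cX k2.
have nX u v : u \in V :\: [set x; y] -> u != v -> ~~ (V :\: [set x;
  y] :\ v \subset X).
  move=> uV uv; rewrite X0 subset0; apply/set0Pn; exists u.
  by rewrite in_setD1 uv uV.
have [b1 b1y b1a] := neighbour_neq e_sym c aV (nX b a bV (introN eqP (nesym
  (elimN eqP ab)))).
have [b1V _ b1x b1ny] := nby_neq e_sym e_irr c b1y.
have ab1 : a != b1 by rewrite eq_sym.
have [b2 b2y b21] := neighbour_neq e_sym c (inner_mem b1V b1x b1ny) (nX a b1 aV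
  ab1).
by exists b1, b2; split=> //; rewrite eq_sym.
Qed.

(** A largest clique through [x] in [V :\ y] will do unless it contains all neighbours of [y]; two
    of these then form a triangle with [y]. *)
Lemma triangle_half x y : reduced x y -> 2 < k -> in_triangle x ->
  admissible x y \/ in_triangle y /\ exists K, [/\ x \in K, clique e K
    & N y \subset K].
Proof.
move=> c k2 /exists_inP[a ax /exists_inP[b bx eab]].
have [aV exa aney anex] := nby_neq e_sym e_irr (reduced_sym e_sym c) ax.
have [bV exb bney bnex] := nby_neq e_sym e_irr (reduced_sym e_sym c) bx.
have ab := adj_neq e_irr eab.
pose P K := [&& x \in K, K \subset V :\ y & cliqueb K].
have P0 : P [set x; a; b].
  apply/and3P; split; first by rewrite !inE eqxx.
    apply/subsetP=> z; rewrite !inE -orbA => /or3P[]/eqP->.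
    - by rewrite (reduced_neq c) (reduced_x c).
    - by rewrite aney.
    by rewrite bney.
  apply/cliqueP=> u v; rewrite !inE -!orbA.
  move=> /or3P[]/eqP-> /or3P[]/eqP->; rewrite ?eqxx // => _;
    rewrite // e_sym //.
case: (arg_maxnP (fun K => #|K|) P0) => K /and3P[xK sK /cliqueP Kc] maxK.
have cK : 2 < #|K|.
  apply: leq_trans (maxK _ P0); rewrite -setUA cardsU1 cards2 !inE negb_or ab.
  by rewrite ![x == _]eq_sym anex bnex.
have [sNK | /subsetPn[b' b'N b'K]] := boolP (N y \subset K); last first.
  left; apply: (@clique_admissible _ e V X k e_sym e_irr IH k_gt1 cX x y K b')
    => //.
  move=> v vV vK vy; apply: (edge_not_clique e_sym Kc vK).
  apply/negP=> cvK; have : P (v |: K).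
    by rewrite /P in_setU1 xK orbT cvK andbT subUset sub1set sK !inE vy vV.
  by move/maxK; rewrite /= cardsU1 vK ltnn.
right; split; last by exists K.
have [b1 [b2 [b1y b2y b12]]] :=
  two_neighbours c k2 (inner_mem aV anex aney) (inner_mem bV bnex bney) ab.
exact: in_triangleI b1y b2y (Kc _ _ (subsetP sNK _ b1y) (subsetP sNK _ b2y)
  b12).
Qed.

(** If [triangle_half] fails from both sides, the neighbours of [y] are in a clique with [x], hence
    adjacent to [x], and conversely. *)
Lemma triangle_admissible x y : reduced x y -> 2 < k -> in_triangle x ->
  admissible x y.
Proof.
move=> c k2 tx; have c' := reduced_sym e_sym c.
have [// | [ty [K [xK Kc sNK]]]] := triangle_half c k2 tx.
have [g | [_ [K' [yK' K'c sNK']]]] := triangle_half c' k2 ty;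
  first exact: admissible_paths_sym.
have sub u v (L : {set T}) : u \in L -> clique e L -> N v \subset L ->
    e u v = false -> N v \subset N u.
  move=> uL Lc sL nuv; apply/subsetP=> z zv; rewrite in_nb.
  have zL := subsetP sL z zv; move: zv; rewrite in_nb => /andP[-> evz] /=.
  by apply: Lc => //; apply: contraTneq evz => <-; rewrite e_sym nuv.
have NE : N x = N y.
  apply/eqP; rewrite eqEsubset (sub _ _ _ yK' K'c sNK') ?(sub _ _ _ xK Kc sNK)
    //.
    exact: reduced_nadj c.
  exact: reduced_nadj c'.
apply: (@twin_clique_admissible _ e V X k e_sym e_irr IH cX x y (N y)) => //.
  exact: cliqueS sNK Kc.
case/exists_inP: ty => a ay /exists_inP[b by_ eab].
by apply/card_gt1P; exists a, b; split=> //; apply: adj_neq eab.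
Qed.

(** * Adjacent vertices with two common neighbours in the neighbourhood of x *)

Definition diamond x := [exists w1 in N x, [exists w2 in N x, (w1 != w2) &&
  [exists p in N w1 :&: N w2, [exists q in N w1 :&: N w2, e p q]]]].

(** The lengths from [x] to the clique [Q] run from 2 to [#|Q| + 2]. A vertex that sees [x] sees
    neither [w1] nor [w2], and by maximality no vertex outside [H] sees [w1], [w2] and all of [Q],
    so the loss is at most [#|Q|]. A bad piece hangs on [x], [w1] and [w2]; there [[set w1; w2]] is
    contracted, with lengths 3 and 4. *)
Lemma diamond_half x y w1 w2 p q : reduced x y -> 2 < k ->
  ~~ in_triangle x -> ~~ in_triangle y ->
    w1 \in N x -> w2 \in N x -> w1 != w2 ->
    p \in N w1 :&: N w2 -> q \in N w1 :&: N w2 -> e p q ->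
  admissible x y \/ N y \subset [set w1; w2].
Proof.
move=> c k2 tx ty w1x w2x w12 pw qw epq; have X0 := X_eq0 cX k2.
have c' := reduced_sym e_sym c.
have [w1V exw1 w1y w1nx] := nby_neq e_sym e_irr c' w1x.
have [w2V exw2 w2y w2nx] := nby_neq e_sym e_irr c' w2x.
have [sNw | /subsetPn[b0 b0y b0w]] := boolP (N y \subset [set w1; w2]);
  first by right.
pose P Q := (Q \subset N w1 :&: N w2) && cliqueb Q.
have pq := adj_neq e_irr epq.
have P0 : P [set p; q].
  rewrite /P subUset !sub1set pw qw; apply/cliqueP=> u v; rewrite !in_set2.
  by move=> /orP[]/eqP-> /orP[]/eqP->; rewrite ?eqxx // e_sym.
case: (arg_maxnP (fun Q => #|Q|) P0) => Q /andP[sQ /cliqueP Qc] maxQ.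
have cQ : 1 < #|Q| by have := maxQ _ P0; rewrite /= cards2 pq.
have Qw u : u \in Q -> [/\ u \in V, e w1 u & e w2 u].
  by move/(subsetP sQ); rewrite in_setI !in_nb => /andP[/andP[-> ->] /andP[]].
have notQ z w : ~~ in_triangle z -> w \in N z -> (w == w1) || (w == w2) ->
  {in Q, forall u, e z u = false}.
  move=> tz wz wE u uQ; have [uV ew1u ew2u] := Qw u uQ;
    apply: contraNF tz => ezu.
  by apply: (in_triangleI wz (b := u)); rewrite ?in_nb ?uV //;
    case/orP: wE => /eqP->.
have adjQ z : ~~ in_triangle z -> {in Q &, forall u v, e z u -> e z v -> u = v}.
  move=> tz u v uQ vQ ezu ezv; apply: contraNeq tz => uv.
  have [uV _ _] := Qw u uQ; have [vV _ _] := Qw v vQ.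
  by apply: (in_triangleI (a := u) (b := v)); rewrite ?in_nb ?uV ?vV //;
    apply: Qc.
have notinQ z : ~~ in_triangle z -> z \notin Q.
  move=> tz; apply/negP=> zQ; have [zV ew1z _] := Qw z zQ.
  have /card_gt0P[u] : 0 < #|Q :\ z| by move: cQ; rewrite (cardsD1 z Q) zQ.
  rewrite in_setD1 => /andP[uz uQ].
  have w1z : w1 \in N z by rewrite in_nb w1V e_sym.
  have := notQ z w1 tz w1z; rewrite eqxx => /(_ isT u uQ).
  by rewrite Qc // eq_sym.
have xQ := notinQ x tx; have yQ := notinQ y ty.
have xadj : {in Q, forall u, e x u = false} by apply: notQ tx w1x _;
  rewrite eqxx.
have wQ w : (w == w1) || (w == w2) -> w \notin Q.
  move=> wE; apply/negP=> /Qw[_ ew1 ew2].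
  by case/orP: wE => /eqP wE; subst w; rewrite e_irr in ew1 ew2.
have w1Q : w1 \notin Q by apply: wQ; rewrite eqxx.
have w2Q : w2 \notin Q by apply: wQ; rewrite eqxx orbT.
set H := [set x; w1; w2] :|: Q.
have inH z : (z \in H) = [|| z == x, z == w1, z == w2 | z \in Q].
  by rewrite !in_setU !in_set1 -!orbA.
(* As [y] is in no triangle, it has at most one neighbour in [Q], and if it has one, it sees neither
   [w1] nor [w2]. *)
have [b by_ bH] : exists2 b, b \in N y & b \notin H.
  have [b0Q | b0Q] := boolP (b0 \in Q); last first.
    exists b0; rewrite // inH (negPf b0Q) orbF.
    have [_ _ /negPf-> _] := nby_neq e_sym e_irr c b0y.
    by move: b0w; rewrite in_set2.
  have [w1N w2N] : w1 \notin N y /\ w2 \notin N y.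
    split; apply/negP=> wN; move: (b0y); rewrite in_nb => /andP[_].
      by rewrite (notQ y w1 ty wN) ?eqxx.
    by rewrite (notQ y w2 ty wN) ?eqxx ?orbT.
  have [b1 [b2 [b1y b2y b12]]] :=
    two_neighbours c k2 (inner_mem w1V w1nx w1y) (inner_mem w2V w2nx w2y) w12.
  have adj z : z \in N y -> e y z by rewrite in_nb => /andP[].
  have main z : z \in N y -> z != b0 -> z \notin H.
    move=> zy zb; rewrite inH !negb_or; apply/and4P; split.
    - by have [] := nby_neq e_sym e_irr c zy.
    - by apply: contraNneq w1N => <-.
    - by apply: contraNneq w2N => <-.
    by apply: contraNN zb => zQ; apply/eqP/(adjQ y ty) => //; apply: adj.
  have [b1E | b1b] := eqVneq b1 b0; last by exists b1; rewrite ?main.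
  by exists b2; rewrite // main // -b1E eq_sym.
left.
have [bV eyb bx bny] := nby_neq e_sym e_irr c by_.
have sQV : Q \subset V by apply/subsetP=> z /Qw[].
have sHV : H \subset V by rewrite !subUset !sub1set (reduced_x c) w1V w2V.
have xH : x \in H by rewrite inH eqxx.
have yH : y \notin H.
  rewrite inH (negPf yQ) orbF eq_sym (negPf (reduced_neq c)) eq_sym (negPf w1y).
  by rewrite eq_sym (negPf w2y).
have Q0 : Q != set0 by rewrite -card_gt0; apply: ltnW.
have yW : y \in V :\: H by rewrite inE yH (reduced_y c).
have sC := subsetP (comp_sub e yW).
have sQH : Q \subset H by apply: subsetUr.
have tail : pathl e (y |: (V :\: V)) y y 0 by apply: pathl_refl; rewrite setU11.
have yC : y \notin component e (V :\: H) y :\ y by rewrite !inE eqxx.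
have [| | | | [D [d Dd]] | //] :=
  @contraction_admissible _ e V X k e_sym e_irr IH k_gt1 cX x y V H Q y 0
    #|Q|.+1 #|Q|
    c (subxx _) sHV sQH xH xQ Q0 (reduced_y c) yH tail _ _ yC (ltnSn _).
- by move=> v _; apply/subsetP=> w; rewrite in_nb => /andP[].
- rewrite X0 subset0; apply/set0Pn; exists b; rewrite in_setD1 bny.
  by apply: (comp_closed yW (comp_refl _ _ _) _ eyb); rewrite inE bH.
- move=> v; rewrite in_setD1 => /andP[vy /sC];
  rewrite in_setD => /andP[vH vV] _.
  have vnb z : z \in nb e H v -> e v z by rewrite in_nb => /andP[].
  case: (boolP (hit e Q v)) => [/hitP[u uQ euv] | noh].
    have [uV ew1u ew2u] := Qw u uQ.
    case: (boolP (e v x)) => evx.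
      have : nb e H v \subset x |: Q.
        apply/subsetP=> z; rewrite in_nb inH in_setU1 => /andP[zH evz].
        case/or4P: zH => [-> // | zE | zE | ->]; rewrite ?orbT //;
          move/eqP: zE => zE; subst z.
        - case/negP: tx; apply: (in_triangleI (a := v) (b := w1)) => //.
          by rewrite in_nb vV e_sym.
        case/negP: tx; apply: (in_triangleI (a := v) (b := w2)) => //.
        by rewrite in_nb vV e_sym.
      by move/subset_leq_card/leq_trans; apply; rewrite cardsU1 xQ.
    have [z zQw evz] : exists2 z, z \in w1 |: (w2 |: Q) & ~~ e v z.
      apply/exists_inP; apply: contraNT vH => /exists_inPn all_e.
      have av z : z \in w1 |: (w2 |: Q) -> e v z by move/all_e; rewrite negbK.
      have av1 : e v w1 by apply: av; rewrite setU11.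
      have av2 : e v w2 by apply: av; rewrite !in_setU1 eqxx orbT.
      have Pv : P (v |: Q).
        apply/andP; split; first by rewrite subUset sQ sub1set in_setI !in_nb
          vV ![e _ v]e_sym av1 av2.
        apply/cliqueP/(clique_add e_sym Qc) => z zQ; rewrite e_sym av //.
        by rewrite !in_setU1 zQ !orbT.
      rewrite inH; case: (boolP (v \in Q)) => vQ; rewrite ?orbT //.
      by have := maxQ _ Pv; rewrite /= cardsU1 vQ ltnn.
    have cW : #|(w1 |: (w2 |: Q)) :\ z| = #|Q|.+1.
      apply: succn_inj; transitivity #|w1 |: (w2 |: Q)|.
        by rewrite [RHS](cardsD1 z) zQw.
      by rewrite !cardsU1 in_setU1 negb_or w12 w1Q w2Q.
    rewrite add1n -cW; apply/subset_leq_card/subsetP=> t tH; rewrite in_setD1.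
    have evt := vnb t tH; apply/andP; split;
      first by apply: contraNneq evz => <-.
    move: tH; rewrite in_nb inH !in_setU1 => /andP[/orP[/eqP tx' | -> //] _].
    by rewrite -tx' evt in evx.
  have [evx | evx] := boolP (e v x).
    have : nb e H v \subset [set x].
      apply/subsetP=> z; rewrite in_nb inH in_set1 => /andP[zH evz].
      case/or4P: zH => [-> // | zE | zE | zQ].
      - move/eqP: zE => zE; subst z; case/negP: tx;
        apply: (in_triangleI (a := v) (b := w1)) => //.
        by rewrite in_nb vV e_sym.
      - move/eqP: zE => zE; subst z; case/negP: tx;
        apply: (in_triangleI (a := v) (b := w2)) => //.
        by rewrite in_nb vV e_sym.
      by case/negP: noh; apply/hitP; exists z; rewrite // e_sym.
    by move/subset_leq_card/leq_trans; apply; rewrite cards1; apply: ltnW.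
  have : nb e H v \subset [set w1; w2].
    apply/subsetP=> z; rewrite in_nb inH in_set2 => /andP[zH evz].
    case/or4P: zH => [/eqP zx | -> // | -> | zQ]; rewrite ?orbT //.
      by rewrite -zx evz in evx.
    by case/negP: noh; apply/hitP; exists z; rewrite // e_sym.
  by move/subset_leq_card/leq_trans; apply; apply: leq_trans (card2_le _ _) _.
- exists 2, 1; split=> [|i i_lt u uQ]; first by left.
  rewrite mul1n; have [iQ | iQ] := ltnP i #|Q|.
    have [q1 q1Q p1] := clique_path_to Qc uQ iQ; have [_ ew1q _] := Qw _ q1Q.
    have p2 := pathl_cons ew1q w1Q p1.
    have x2 : x \notin w1 |: Q by rewrite in_setU1 negb_or xQ eq_sym w1nx.
    have p3 := pathl_cons exw1 x2 p2.
    by apply: pathl_sub p3; apply/subsetP=> z;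
      rewrite inH !in_setU1 => /or3P[->|->|->]; rewrite ?orbT.
  have {i_lt iQ} -> : i = #|Q| by apply/eqP; rewrite eqn_leq iQ -ltnS i_lt.
  (* The longest path runs [x], [w1], [q1], [w2] and then through all of [Q :\ q1]. *)
  have /card_gt0P[q1] : 0 < #|Q :\ u| by move: cQ; rewrite (cardsD1 u Q) uQ.
  rewrite in_setD1 => /andP[q1u q1Q]; have [_ ew1q ew2q] := Qw _ q1Q.
  have uQ1 : u \in Q :\ q1 by rewrite in_setD1 uQ eq_sym q1u.
  have lt2 : #|Q|.-2 < #|Q :\ q1|.
    by move: cQ; rewrite (cardsD1 q1 Q) q1Q; case: #|Q :\ q1|.
  have [q2 q2Q p1] := clique_path_to (cliqueS (subD1set Q q1) Qc) uQ1 lt2.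
  have [_ _ ew2q2] := Qw q2 (subsetP (subD1set Q q1) _ q2Q).
  have w2Q1 : w2 \notin Q :\ q1 by rewrite in_setD1 (negPf w2Q) andbF.
  have p2 := pathl_cons ew2q2 w2Q1 p1.
  have eq1 : e q1 w2 by rewrite e_sym.
  have q12 : q1 \notin w2 |: (Q :\ q1).
    by rewrite in_setU1 negb_or in_setD1 eqxx andbT (adj_neq e_irr).
  have p3 := pathl_cons eq1 q12 p2.
  have w13 : w1 \notin q1 |: (w2 |: (Q :\ q1)).
    by rewrite !in_setU1 !negb_or in_setD1 (negPf w1Q) andbF w12 (adj_neq
      e_irr).
  have p4 := pathl_cons ew1q w13 p3.
  have x4 : x \notin w1 |: (q1 |: (w2 |: (Q :\ q1))).
    rewrite !in_setU1 !negb_or in_setD1 (negPf xQ) andbF !andbT eq_sym w1nx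
      eq_sym.
    by rewrite [x == w2]eq_sym w2nx andbT; apply: contraNneq xQ => <-.
  have p5 := pathl_cons exw1 x4 p4.
  have -> : 2 + #|Q| = #|Q|.-2.+4 by case: (#|Q|) cQ => [|[]].
  apply: pathl_sub p5; apply/subsetP=> z; rewrite inH !in_setU1 in_setD1.
  by case/or4P => [->|->|/eqP->|/orP[->|/andP[_ ->]]]; rewrite ?q1Q ?orbT.
have HQ : H :\: Q \subset x |: [set w1; w2].
  apply/subsetP=> z; rewrite in_setD inH in_setU1 in_set2.
  by case/andP=> /negPf-> ; rewrite orbF.
apply: (@bad_piece_admissible _ e V X k e_sym e_irr IH cX x y V H Q [set w1;
  w2] y 0 2 1 D d) => //.
- exact: reduced_y c.
- by rewrite subUset !sub1set !inH !eqxx !orbT.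
- by rewrite in_set2 negb_or ![x == _]eq_sym w1nx.
- by apply/set0Pn; exists w1; rewrite set21.
- case/and5P: Dd => D0 sD _ _ bdV v vD.
  have : v \in component e (V :\: H) y :\ y by apply: (subsetP sD).
  rewrite in_setD1 => /andP[_ /sC]; rewrite in_setD => /andP[vH vV].
  case: (boolP (hit e [set w1; w2] v)) => [/hitP[w wE ewv] | noh].
    have : nb e (x |: [set w1; w2]) v \subset [set w1; w2].
      apply/subsetP=> z; rewrite in_nb in_setU1 =>
        /andP[/orP[/eqP zx | //] evx]; subst z.
      case/negP: tx; apply: (in_triangleI (a := w) (b := v)) => //.
        by case/set2P: wE => ->.
      by rewrite in_nb vV e_sym.
    by move/subset_leq_card/leq_trans; apply; apply: card2_le.
  have : nb e (x |: [set w1; w2]) v \subset [set x].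
    apply/subsetP=> z; rewrite in_nb in_setU1 in_set1 =>
      /andP[/orP[// | zw] evz].
    by case/negP: noh; apply/hitP; exists z; rewrite // e_sym.
  by move/subset_leq_card/leq_trans; apply; rewrite cards1.
have AP34 u o : (u == w1) && (o == w2) || (u == w2) && (o == w1) ->
    pathl e H x u 3 /\ pathl e H x u 4.
  move=> uo; have [exo ox ew] : [/\ e x o, o != x & forall z, z \in Q ->
    e o z /\ e z u].
    case/orP: uo => /andP[/eqP-> /eqP->]; split=> // z /Qw[_ h1 h2];
      by split; rewrite // e_sym.
  have uQ : u \notin Q by apply: wQ; case/orP: uo => /andP[-> _]; rewrite ?orbT.
  have oQ : o \notin Q by apply: wQ; case/orP: uo => /andP[_ ->]; rewrite ?orbT.
  have ou : o != u by case/orP: uo => /andP[/eqP-> /eqP->]; rewrite // eq_sym.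
  have xu : x != u by case/orP: uo => /andP[/eqP-> _]; rewrite eq_sym.
  have uH : u \in H by rewrite inH; case/orP: uo => /andP[-> _]; rewrite ?orbT.
  have oH : o \in H by rewrite inH; case/orP: uo => /andP[_ ->]; rewrite ?orbT.
  have xo : x != o by rewrite eq_sym.
  have p0 : pathl e [set u] u u 0 by apply: pathl_refl; rewrite set11.
  have /card_gt1P[q1 [q2 [q1Q q2Q q12]]] := cQ.
  have qu z : z \in Q -> z \notin [set u].
    by move=> zQ; rewrite in_set1; apply: contraNneq uQ => <-.
  have xq z : z \in Q -> x != z by move=> zQ; apply: contraNneq xQ => ->.
  have oq z : z \in Q -> o != z by move=> zQ; apply: contraNneq oQ => ->.
  have p1 := pathl_cons (ew q1 q1Q).2 (qu q1 q1Q) p0.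
  split.
    have o1 : o \notin q1 |: [set u] by rewrite in_setU1 in_set1 negb_or ou oq.
    have x2 : x \notin o |: (q1 |: [set u]).
      by rewrite !in_setU1 in_set1 !negb_or xu (xq q1 q1Q) xo.
    apply: pathl_sub (pathl_cons exo x2 (pathl_cons (ew q1 q1Q).1 o1 p1)).
    by rewrite !subUset !sub1set xH oH uH (subsetP sQH).
  have q21 : q2 \notin q1 |: [set u] by rewrite in_setU1 negb_or qu // eq_sym
    q12.
  have o2 : o \notin q2 |: (q1 |: [set u]).
    by rewrite !in_setU1 in_set1 !negb_or ou (oq q1 q1Q) (oq q2 q2Q).
  have x3 : x \notin o |: (q2 |: (q1 |: [set u])).
    by rewrite !in_setU1 in_set1 !negb_or xu (xq q1 q1Q) (xq q2 q2Q) xo.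
  have e21 : e q2 q1 by apply: Qc; rewrite // eq_sym.
  apply: pathl_sub (pathl_cons exo x3 (pathl_cons (ew q2 q2Q).1 o2 (pathl_cons
    e21 q21 p1))).
  by rewrite !subUset !sub1set xH oH uH !(subsetP sQH).
exists 3, 1; split=> [|i i_lt u]; first by left.
rewrite in_set2 mul1n => uw;
  have [o uo] : exists o, (u == w1) && (o == w2) || (u == w2) && (o == w1).
  by case/orP: uw => ->; [exists w2 | exists w1]; rewrite eqxx ?orbT.
by have [] := AP34 u o uo; case: i i_lt => [|[]].
Qed.

(** If [diamond_half] fails from both sides, with the same four vertices, then [w1] and [w2] are the
    only neighbours of the roots and cut off [p]. *)
Lemma diamond_admissible x y : reduced x y -> 2 < k -> ~~ in_triangle x ->
  ~~ in_triangle y -> diamond x -> admissible x y.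
Proof.
move=> c k2 tx ty /exists_inP[w1 w1x /exists_inP[w2 w2x /andP[w12]]].
case/exists_inP=> p pw /exists_inP[q qw epq]; have c' := reduced_sym e_sym c.
have X0 := X_eq0 cX k2.
have [// | sNy] := diamond_half c k2 tx ty w1x w2x w12 pw qw epq.
have [w1V exw1 w1y w1nx] := nby_neq e_sym e_irr c' w1x.
have [w2V exw2 w2y w2nx] := nby_neq e_sym e_irr c' w2x.
have [b1 [b2 [b1y b2y b12]]] :=
  two_neighbours c k2 (inner_mem w1V w1nx w1y) (inner_mem w2V w2nx w2y) w12.
have wy w : w \in [set w1; w2] -> w \in N y.
  have := subsetP sNy _ b1y; have := subsetP sNy _ b2y; move: b1y b2y b12.
  rewrite !in_set2 => h1 h2 b12 /orP[]/eqP E2 /orP[]/eqP E1; subst b1 b2;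
    rewrite ?eqxx // in b12 *; by case/orP=> /eqP->.
have [|sNx] := diamond_half c' k2 ty tx (wy w1 (set21 _ _)) (wy w2 (set22 _ _))
  w12 pw qw epq.
  exact: admissible_paths_sym.
move: (pw) (qw); rewrite !in_setI !in_nb => /andP[/andP[pV e1p] /andP[_ e2p]].
case/andP=> /andP[qV e1q] _.
have notp z : ~~ in_triangle z -> N z \subset [set w1;
  w2] -> w1 \in N z -> p != z.
  move=> tz sz w1z; apply/eqP=> pz; subst z; case/negP: tz.
  by apply: (in_triangleI (a := w1) (b := q)) => //; rewrite in_nb qV.
have pD : p \in V :\: [set x; y] :\: [set w1; w2].
  rewrite in_setD in_set2 negb_or ![p == _]eq_sym !(adj_neq e_irr) //=.
  by apply: inner_mem => //; apply: notp => //; apply: wy; apply: set21.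
suff : 2 < #|[set w1; w2]| by rewrite ltnNge card2_le.
apply: (three_connected c (D := V :\: [set x; y] :\: [set w1; w2]) (z := w1)).
- by apply/set0Pn; exists p.
- exact: subsetDl.
- exact: inner_mem.
- by rewrite in_setD set21.
- by rewrite X0 subset0; apply/set0Pn; exists p.
apply/subsetP=> w /bdP[wV wD [v vD evw]]; move: wD; rewrite in_setD.
rewrite negb_and negbK => /orP[// |]; rewrite in_setD wV andbT negbK in_set2.
move: vD; rewrite in_setD => /andP[vw]; rewrite in_setD => /andP[_ vV].
case/orP=> /eqP wE; subst w; case/negP: vw.
  by apply: (subsetP sNx); rewrite in_nb vV e_sym.
by apply: (subsetP sNy); rewrite in_nb vV e_sym.
Qed.

End TrianglesAndDiamonds.

(** * Complete bipartite graphs *)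

Section TriangleFree.
Variables (T : finType) (e : rel T) (V X : {set T}) (k : nat).
Hypotheses (e_sym : symmetric e) (e_irr : irreflexive e).
Hypothesis IH : forall e' (V' : {set T}) x' y' k' X', #|V'| < #|V| ->
  rooted_graph e' V' x' y' k' X' -> admissible_paths e' V' x' y' k'.
Hypotheses (k_gt1 : 1 < k) (cX : #|X| <= (k <= 2)).
Implicit Types (A B C D H K S U W Q : {set T}) (x y r u v w : T).

Notation N := (nb e V).
Notation reduced := (reduced e V X k).
Notation in_triangle := (in_triangle e V).
Notation bad_piece := (bad_piece e V).
Notation diamond := (diamond e V).
Notation in_square := (in_square e V).
Notation admissible x y := (admissible_paths e V x y k).

Definition common_nb W S := [set w in W | [forall u in S, e u w]].

Lemma common_nbP W S w : reflect (w \in W /\ {in S, forall u,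
  e u w}) (w \in common_nb W S).
Proof.
rewrite inE; apply: (iffP andP) => [[wW /forall_inP h] | [wW h]]; split=> //.
exact/forall_inP.
Qed.

Lemma common_nbS W W' S S' : W \subset W' -> S' \subset S ->
  common_nb W S \subset common_nb W' S'.
Proof.
move=> /subsetP sW /subsetP sS; apply/subsetP=> w /common_nbP[/sW wW h].
by apply/common_nbP; split=> // u /sS/h.
Qed.

Lemma common_nb_disj W S : [disjoint S & common_nb W S].
Proof.
by apply/pred0P=> z /=; apply/negP=> /andP[zS /common_nbP[_ /(_ z zS)]];
  rewrite e_irr.
Qed.

(* Besides (W, r) = (V, y), this is used for W = V :\ y and a neighbour r of y in
   the biclique, in case y is isolated outside of it. *)
Lemma biclique_admissible x y W r S m (C :=
  component e (W :\: (S :|: common_nb (W :\ r) S)) r) :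
    reduced x y -> ~~ in_triangle x -> ~~ diamond x -> W \subset V -> x \in S ->
    S \subset W :\ r -> r \in W -> #|S| <= #|common_nb (W :\ r) S| ->
    (forall v, v \in W :\ r -> v \notin S ->
      #|common_nb (W :\ r) (v |: S)| <= #|S|) ->
    pathl e (r |: (V :\: W)) r y m -> y \notin W :\ r ->
    (forall v, v \in C :\ r -> N v \subset W) -> ~~ (C :\ r \subset X) ->
    #|S| = 1 \/ 2 < k ->
  admissible x y.
Proof.
move=> c tx dx sWV xS sSW rW leST maxS tail yW nbW CX S1k.
set A := common_nb (W :\ r) S in C leST CX nbW; set H := S :|: A in C CX nbW.
have dSA : [disjoint S & A] := common_nb_disj (W :\ r) S.
have SA : biclique e S A by move=> u t uS /common_nbP[_ /(_ u uS)].
have s0 : 0 < #|S| by apply/card_gt0P; exists x.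
have A0 : A != set0 by rewrite -card_gt0; apply: leq_trans leST.
have xA : x \notin A by rewrite (disjointFr dSA xS).
have sAW : A \subset W :\ r by apply/subsetP=> z /common_nbP[].
have sHW' : H \subset W :\ r by rewrite subUset sSW.
have sHW : H \subset W := subset_trans sHW' (subD1set _ _).
have xH : x \in H by rewrite inE xS.
have rH : r \notin H by apply/negP=> /(subsetP sHW'); rewrite !inE eqxx.
have yH : y \notin H by apply: contra yW; apply: (subsetP sHW').
have rWH : r \in W :\: H by rewrite inE rH.
have sC := subsetP (comp_sub e rWH).
have yC : y \notin C :\ r.
  apply: contra yW; rewrite !in_setD1 => /andP[-> /sC].
  by rewrite in_setD => /andP[].
have AN t : t \in A -> t \in N x.
  move=> tA; rewrite in_nb (SA x t xS tA) andbT.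
  by apply: (subsetP sWV); move: (subsetP sAW t tA); rewrite inE => /andP[].
have aS v : v \notin A -> v \in W :\ r -> #|nb e S v| <= #|S|.-1.
  move=> vA vW; have [u uS euv] : exists2 u, u \in S & ~~ e u v.
    apply/exists_inP; apply: contraNT vA => /exists_inPn h.
    by apply/common_nbP; split=> // u /h; rewrite negbK.
  have : nb e S v \subset S :\ u.
    apply/subsetP=> z; rewrite in_nb in_setD1 => /andP[-> evz]; rewrite andbT.
    by apply: contraNneq euv => <-; rewrite e_sym.
  move/subset_leq_card/leq_trans; apply.
  by rewrite (cardsD1 u S) uS.
(* Since [v] is not in [A], it has at most [#|S|.-1] neighbours in [S], which suffices if it has at
   most one in [A]. If it has two in [A], a neighbour in [S] would complete a diamond at [x]; so
   there is none, and [maxS] bounds the neighbours in [A]. *)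
have lossC v : v \in C :\ r -> v \notin X -> #|nb e H v| <= hit e A v + #|S|.-1.
  rewrite in_setD1 => /andP[vr /sC];
    rewrite in_setD inE negb_or => /andP[/andP[vS vA] vW] _.
  have vWr : v \in W :\ r by rewrite in_setD1 vr.
  have vV := subsetP sWV v vW.
  have nbH : #|nb e H v| <= #|nb e S v| + #|nb e A v|.
    apply: leq_trans (leq_card_setU _ _); apply/subset_leq_card/subsetP=> z.
    by rewrite in_setU !in_nb in_setU => /andP[/orP[->|->] ->]; rewrite ?orbT.
  apply: leq_trans nbH _;
    case: (boolP (hit e A v)) => [/hitP[t tA etv] | noh]; last first.
    have -> : nb e A v = set0.
      apply/setP=> z; rewrite in_nb in_set0;
        apply: contraNF noh => /andP[zA evz].
      by apply/hitP; exists z; rewrite // e_sym.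
    by rewrite cards0 addn0 aS.
  have [b1 | b2] := leqP #|nb e A v| 1.
    by rewrite addnC leq_add // aS.
  have -> : nb e S v = set0.
    apply/setP=> u; rewrite in_nb in_set0; apply: contraNF dx => /andP[uS evu].
    have /card_gt1P[w1 [w2 []]] := b2;
      rewrite !in_nb => /andP[w1A ev1] /andP[w2A ev2] w12.
    have uV : u \in V.
      by apply: (subsetP sWV); move: (subsetP sSW u uS); rewrite inE => /andP[].
    apply/exists_inP; exists w1; first exact: AN.
    apply/exists_inP; exists w2; first exact: AN.
    rewrite w12 /=; apply/exists_inP; exists u.
      by rewrite in_setI !in_nb uV ![e _ u]e_sym !SA.
    apply/exists_inP; exists v; last by rewrite e_sym.
    by rewrite in_setI !in_nb vV ![e _ v]e_sym ev1 ev2.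
  have sub : nb e A v \subset common_nb (W :\ r) (v |: S).
    apply/subsetP=> z; rewrite in_nb => /andP[zA evz]; apply/common_nbP; split.
      exact: (subsetP sAW).
    by move=> u; rewrite in_setU1 => /orP[/eqP-> // | uS]; apply: SA.
  rewrite cards0 add0n add1n prednK //.
  exact: leq_trans (subset_leq_card sub) (maxS v vWr vS).
have APs : progression #|S| (fun n => {in A, forall u, pathl e H x u n}).
  exists 1, 2; split=> [|i i_lt u uA]; first by right.
  rewrite add1n mul2n; apply: biclique_path_odd => //.
  exact: leq_trans leST.
have [|[D [d Dd]]|//] :=
  @contraction_admissible _ e V X k e_sym e_irr IH k_gt1 cX x y W H A r m #|S|
    #|S|.-1
    c sWV sHW (subsetUr _ _) xH xA A0 rW rH tail nbW CX yC _ lossC APs.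
  by rewrite prednK.
have HA : H :\: A = S.
  apply/setP=> z; rewrite in_setD in_setU; case: (boolP (z \in S)) => zS /=.
    by rewrite (disjointFr dSA zS).
  by rewrite andNb.
rewrite HA in Dd; case/and5P: (Dd) => D0 sD dC bdC bdV.
have DW v : v \in D -> [/\ v \in W :\ r, v \notin S & v \notin A].
  move/(subsetP sD); rewrite in_setD1 => /andP[vr /sC];
    rewrite in_setD in_setU negb_or.
  by case/andP=> /andP[-> ->] vW; rewrite in_setD1 vr.
have DV v : v \in D -> v \in V.
  by case/DW; rewrite in_setD1 => /andP[_ /(subsetP sWV)].
have sDxy : D \subset V :\: [set x; y].
  apply/subsetP=> z zD; have [zW zS zA] := DW z zD; apply: inner_mem;
    first exact: DV.
    by apply: contraNneq zS => ->.
  by apply: contraNneq yW => <-.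
have [S1 | S2] := leqP #|S| 1.
  (* The bad piece does not see [x] either, because the neighbours of [x] in [W :\ r] are all in
     [A]; so [d] alone would cut it off. *)
  have SE : S = [set x].
    by apply/esym/eqP; rewrite eqEcard sub1set xS cards1.
  suff : 1 < #|[set d]| by rewrite cards1.
  apply: leq_trans (reduced_rooted c D0 sDxy) _;
    apply/subset_leq_card/subsetP=> w wb.
  have := subsetP bdV w wb;
    rewrite SE in_setU1 !in_set1 => /orP[// | /eqP wx]; subst w.
  case/bdP: wb => _ _ [v vD evx]; have [vW _ /negP[]] := DW v vD.
  by apply/common_nbP; split=> // u; rewrite SE in_set1 => /eqP->;
    rewrite e_sym.
have k2 : 2 < k by case: S1k => // S1; rewrite S1 in S2.
have X0 := X_eq0 cX k2.
have [S3 | S3] := leqP #|S| 2.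
  (* Contracting [p] alone would give [s = 1] and allow no loss, whereas a vertex of [D] may see [x]
     but not [p]. Hence the detour through a separation of order 3. *)
  have /card_gt0P[p] : 0 < #|S :\ x| by move: S2; rewrite (cardsD1 x S) xS.
  rewrite in_setD1 => /andP[px pS].
  have SE : S = [set x; p].
    apply/esym/eqP; rewrite eqEcard subUset !sub1set xS pS cards2 eq_sym px.
    exact: S3.
  have pW := subsetP sSW p pS.
  have pV : p \in V by apply: (subsetP sWV); move: pW; rewrite inE => /andP[].
  have py : p != y by apply: contraNneq yW => <-.
  have /card_gt1P[w1 [w2 [w1A w2A w12]]] : 1 < #|A| by apply: leq_trans leST.
  have wN w : w \in A -> w \in N p :\: [set x; y].
    move=> wA; have wW := subsetP sAW w wA; apply: inner_mem.
    - by rewrite in_nb SA // andbT; apply: (subsetP sWV); move: wW;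
      rewrite inE => /andP[].
    - by apply: contraNneq xA => <-.
    by apply: contraNneq yW => <-.
  apply: (@three_separation _ e V X k e_sym e_irr IH cX x y p d D w1 w2) => //.
  - exact: inner_mem.
  - exact: wN.
  - exact: wN.
  - apply/subsetP=> z zD; have [zW zS zA] := DW z zD.
    rewrite !in_setD !in_setU !in_set1 (DV z zD) andbT !negb_or -!andbA.
    apply/and5P; split.
    + by apply: contraNneq zA => ->.
    + by apply: contraNneq zA => ->.
    + by apply: contraNneq zS => ->.
    + by apply: contraNneq yW => <-.
    by apply: contraNneq zS => ->.
  apply: subset_trans bdV _; rewrite SE; apply/subsetP=> z.
  by rewrite !inE orbC.
have xSx : x \notin S :\ x by rewrite !inE eqxx.
have [l lE] : exists l, #|S| = l.+3 by case: (#|S|) S3 => [|[|[|l]]] // _;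
  exists l.
have Dd' : bad_piece C r (H :\: A) D d by rewrite HA.
apply: (@bad_piece_admissible _ e V X k e_sym e_irr IH cX x y W H A (S :\ x) r
  m l.+2 l.+1 D d) => //.
- exact: subset_trans (subD1set _ _) (subsetUl _ _).
- by rewrite -card_gt0; move: S2; rewrite (cardsD1 x S) xS.
- by rewrite HA setD1K.
- move=> v vD; have [vW vS vA] := DW v vD; rewrite setD1K //.
  have := aS v vA vW; rewrite lE /=.
  case: (boolP (hit e (S :\ x) v)) => [_ | noh] le1; first by rewrite add1n.
  have : nb e S v \subset [set x].
    apply/subsetP=> z; rewrite in_nb in_set1 => /andP[zS evz];
      apply: contraNT noh => zx.
    by apply/hitP; exists z; rewrite ?in_setD1 ?zx // e_sym.
  by move/subset_leq_card/leq_trans; apply; rewrite cards1.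
exists 2, 2; split=> [|i i_lt u]; first by right.
rewrite in_setD1 => /andP[ux uS]; rewrite mul2n add2n.
apply: biclique_path_even => //; rewrite ?lE //; first by rewrite eq_sym.
by apply: leq_trans leST; rewrite lE; exact: ltnW.
Qed.

(** The class of [x] in a complete bipartite graph avoiding [y]. The other class must not be
    smaller, for the odd paths from [x] use equally many vertices of both. *)
Definition stem x y S := [&& x \in S, S \subset V :\ y
  & #|S| <= #|common_nb (V :\ y) S|].

(** The maximum is over cardinalities and not only for inclusion, so that it persists when one
    vertex is exchanged. *)
Definition maxstem x y S :=
  stem x y S && [forall S' : {set T}, stem x y S' ==> (#|S'| <= #|S|)].

Lemma maxstemP x y S : maxstem x y S ->
  stem x y S /\ forall S', stem x y S' -> #|S'| <= #|S|.
Proof. by case/andP=> h /forallP m; split=> // S' h';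
  apply: (implyP (m S')). Qed.

Lemma neighbour_exists x y : reduced x y -> exists b, b \in N x.
Proof.
move=> c; have /set0Pn[v vD] : V :\: [set x; y] != set0.
  by apply: contraNneq (reduced_inner c) => ->; rewrite sub0set.
apply/set0Pn; apply/eqP=> Nx0; suff : 1 < #|[set y]| by rewrite cards1.
have D0 : V :\: [set x; y] != set0 by apply/set0Pn; exists v.
apply: leq_trans (reduced_rooted c D0 (subxx _)) _.
apply/subset_leq_card/subsetP=> w /bdP[wV];
  rewrite in_setD wV andbT negbK in_set2.
case/orP=> [/eqP wx | wy] [u uD euw]; last by rewrite in_set1.
have : u \in N x by rewrite in_nb -wx e_sym euw andbT; move: uD;
  rewrite inE => /andP[].
by rewrite Nx0 in_set0.
Qed.

Lemma maxstem_exists x y : reduced x y -> exists S, maxstem x y S.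
Proof.
move=> c; have st0 : stem x y [set x].
  rewrite /stem set11 sub1set !inE (reduced_neq c) (reduced_x c) cards1 /=.
  have [b] := neighbour_exists c; have c' := reduced_sym e_sym c.
  move=> /(nby_neq e_sym e_irr c')[bV exb bny bx].
  apply/card_gt0P; exists b; apply/common_nbP; split;
    first by rewrite in_setD1 bny.
  by move=> u; rewrite in_set1 => /eqP->.
case: (arg_maxnP (fun S => #|S|) st0) => S stS maxS; exists S.
by rewrite /maxstem stS; apply/forallP=> S'; apply/implyP/maxS.
Qed.

(** A second vertex of [S] would lie opposite to [x] in a 4-cycle. *)
Lemma stem1 x y S : reduced x y -> k <= 2 -> ~~ in_square x y ->
  stem x y S -> #|S| = 1.
Proof.
move=> c k2 nc4 /and3P[xS sS leST]; apply/eqP; rewrite eqn_leq andbC.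
apply/andP; split; first by apply/card_gt0P; exists x.
rewrite leqNgt; apply: contra nc4 => S2.
have /card_gt0P[v] : 0 < #|S :\ x| by move: S2; rewrite (cardsD1 x S) xS.
rewrite in_setD1 => /andP[vx vS]; have := subsetP sS v vS;
  rewrite in_setD1 => /andP[vy vV].
apply/exists_inP; exists v; first exact: inner_mem.
apply: leq_trans S2 (leq_trans leST _);
  apply/subset_leq_card/subsetP=> w /common_nbP[].
rewrite in_setD1 in_setI !in_nb => /andP[_ ->] h.
by rewrite !h.
Qed.

Lemma X_single z : z \in X -> X = [set z] /\ k <= 2.
Proof.
move=> zX; have X0 : 0 < #|X| by apply/card_gt0P; exists z.
have := leq_trans X0 cX; case: (leqP k 2) cX => // _ le1 _; split=> //;
  apply/esym/eqP.
by rewrite eqEcard sub1set zX cards1.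
Qed.

Lemma deg2 x y v : reduced x y -> v \in V :\: [set x; y] -> 1 < #|N v|.
Proof.
move=> c vV; have v0 : [set v] != set0 by apply/set0Pn; exists v; rewrite set11.
have sv : [set v] \subset V :\: [set x; y] by rewrite sub1set.
apply: leq_trans (reduced_rooted c v0 sv) _; apply/subset_leq_card/subsetP=> w.
by case/bdP=> wV _ [u]; rewrite in_set1 => /eqP-> evw; rewrite in_nb wV.
Qed.

Lemma neighbour_neq_exceptional x y z : reduced x y -> z \in X ->
  z \in V :\: [set x; y] ->
  exists2 b, b \in N y & b != z.
Proof.
move=> c zX zV; apply: (neighbour_neq e_sym c zV);
  apply: contra (reduced_inner c) => sub.
have [XE _] := X_single zX; apply/subsetP=> v vV; rewrite XE in_set1.
apply: contraT => vz; have := subsetP sub v;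
  rewrite in_setD1 vz vV XE in_set1 (negPf vz).
by move/(_ isT).
Qed.

Lemma maxstem_admissible x y S b : reduced x y -> ~~ in_triangle x ->
  ~~ diamond x ->
    (k <= 2 -> ~~ in_square x y) -> maxstem x y S -> b \in N y ->
    b \notin S :|: common_nb (V :\ y) S ->
  admissible x y.
Proof.
move=> c tx dx nc4 /maxstemP[stS maxS] bN bH; case/and3P: (stS) => xS sS leST.
have [bV eyb bx bny] := nby_neq e_sym e_irr c bN.
set H := S :|: _ in bH.
have yH : y \notin H.
  rewrite in_setU negb_or; apply/andP; split.
    by apply/negP=> /(subsetP sS); rewrite !inE eqxx.
  by apply/negP=> /common_nbP[]; rewrite !inE eqxx.
have yVH : y \in V :\: H by rewrite inE yH (reduced_y c).
have bC : b \in component e (V :\: H) y.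
  by apply: (comp_closed yVH (comp_refl _ _ _) _ eyb); rewrite inE bH.
have S1k : #|S| = 1 \/ 2 < k.
  by case: (leqP k 2) => k2; [left; apply: stem1 c k2 (nc4 k2) stS | right].
have [CX | CX] := boolP (component e (V :\: H) y :\ y \subset X); last first.
  apply: (@biclique_admissible x y V y S 0) => //.
  - exact: reduced_y c.
  - move=> v; rewrite in_setD1 => /andP[vy vV] vS; rewrite leqNgt;
    apply/negP=> lt1.
    have : stem x y (v |: S).
      rewrite /stem in_setU1 xS orbT subUset sub1set !inE vy vV sS /=.
      by rewrite cardsU1 vS add1n.
    by move/maxS; rewrite cardsU1 vS ltnn.
  - by apply: pathl_refl; rewrite setU11.
  - by rewrite !inE eqxx.
  by move=> v _; apply/subsetP=> w; rewrite in_nb => /andP[].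
(* Here [b] is exceptional and alone with [y] in the component. Another neighbour [b'] of [y] and
   another neighbour [a] of [b] are then in [H] and adjacent to [x], which gives paths of lengths 2
   and 3. *)
have bX : b \in X by apply: (subsetP CX); rewrite in_setD1 bny.
have [XE k2] := X_single bX; have kE : k = 2 by apply/eqP; rewrite eqn_leq k2.
have Sx : S = [set x].
  apply/esym/eqP; rewrite eqEcard sub1set xS cards1.
  by case: S1k => [->|] //; rewrite kE.
have HN z : z \in H -> z != x -> e x z.
  rewrite in_setU => /orP[|/common_nbP[_ /(_ x xS)] //].
  by rewrite Sx in_set1 => ->.
have NH z : z \in V -> z != y -> e x z -> z \in H.
  move=> zV zy exz; rewrite in_setU; apply/orP; right; apply/common_nbP.
  by rewrite in_setD1 zy; split=> // u; rewrite Sx in_set1 => /eqP->.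
have Cyb z : z \in component e (V :\: H) y -> z != y -> z = b.
  by move=> zC zy; apply/eqP; have := subsetP CX z;
    rewrite in_setD1 zy zC XE in_set1 => /(_ isT).
have inH v z : v \in component e (V :\: H) y -> z \in V -> e v z -> z != y ->
  z != b -> z \in H.
  move=> vC zV evz zy zb; apply: contraNT zb => zH; apply/eqP/Cyb => //.
  by apply: (comp_closed yVH vC) evz; rewrite inE zH.
have bI := inner_mem bV bx bny.
have [b' b'N b'b] := neighbour_neq_exceptional c bX bI.
have [b'V eyb' b'x b'y] := nby_neq e_sym e_irr c b'N.
have exb' : e x b' by apply: HN b'x; apply: inH eyb' b'y b'b => //;
  apply: comp_refl.
have [a aN ay] : exists2 a, a \in N b & a != y.
  have /card_gt1P[a1 [a2 [a1N a2N a12]]] := deg2 c bI.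
  have [a1y | a1y] := eqVneq a1 y; last by exists a1.
  by exists a2; rewrite // -a1y eq_sym.
have [aV eba] : a \in V /\ e b a by apply/andP; move: aN; rewrite in_nb.
have ax : a != x.
  apply: contraNneq bH => aE; subst a; apply: NH => //.
  by rewrite e_sym.
have exa : e x a.
  apply: HN ax; apply: (inH b a bC aV eba ay).
  by rewrite eq_sym; apply: adj_neq eba.
have eb'y : e b' y by rewrite e_sym.
have eby : e b y by rewrite e_sym.
have eab : e a b by rewrite e_sym.
have py : pathl e [set y] y y 0 by apply: pathl_refl; rewrite set11.
have p1 z : z != y -> e z y -> pathl e (z |: [set y]) z y 1.
  by move=> zy ezy; apply: pathl_cons ezy _ py; rewrite in_set1.
have xy := reduced_neq c.
exists 2, 1; split=> [|i i_lt]; first by left.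
split; first by rewrite leq_addr.
rewrite kE in i_lt; case: i i_lt => [|[|]] // _.
  apply: (pathl_sub _ (pathl_cons exb' _ (p1 b' b'y eb'y))).
    by rewrite !subUset !sub1set (reduced_x c) (reduced_y c) b'V.
  by rewrite in_setU1 in_set1 negb_or xy eq_sym b'x.
have p2 : pathl e (a |: (b |: [set y])) a y 2.
  apply: (pathl_cons eab _ (p1 b bny eby)).
  by rewrite in_setU1 in_set1 negb_or ay andbT (adj_neq e_irr).
apply: (pathl_sub _ (pathl_cons exa _ p2)).
  by rewrite !subUset !sub1set (reduced_x c) (reduced_y c) aV bV.
by rewrite !in_setU1 in_set1 !negb_or xy ![x == _]eq_sym ax bx.
Qed.

(** With [y] deleted, the edge from [u] to [y] is the tail. As [#|S| < k], the vertex [u] has a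
    neighbour besides [y] and [S]. If this were exceptional and alone with [u] in the component, all
    its neighbours would be neighbours of [x], and there would be a 4-cycle at [x]. *)
Lemma reroot_admissible x y u S : reduced x y -> ~~ in_triangle x ->
  ~~ diamond x ->
    (k <= 2 -> ~~ in_square x y) -> u \in N y -> u \notin X -> u \in N x ->
    x \in S -> S \subset V :\ y :\ u -> #|S| <= #|common_nb (V :\ y :\ u) S| ->
    (forall v, v \in V :\ y :\ u -> v \notin S ->
       #|common_nb (V :\ y :\ u) (v |: S)| <= #|S|) ->
    N y :\ u \subset common_nb (V :\ y :\ u) S -> #|S| < k ->
      #|S| = 1 \/ 2 < k ->
  admissible x y.
Proof.
move=> c tx dx nc4 uy uX ux xS sS leST maxS sNy Sk S1k.
have [uV eyu unx uny] := nby_neq e_sym e_irr c uy.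
have exu : e x u by move: ux; rewrite in_nb => /andP[].
set A := common_nb (V :\ y :\ u) S in leST sNy.
have uW : u \in V :\ y by rewrite in_setD1 uny.
have sAW : A \subset V :\ y :\ u by apply/subsetP=> z /common_nbP[].
have uH : u \notin S :|: A.
  rewrite in_setU negb_or; apply/andP; split.
    by apply/negP=> /(subsetP sS); rewrite !inE eqxx.
  by apply/negP=> /(subsetP sAW); rewrite !inE eqxx.
have uWH : u \in V :\ y :\: (S :|: A) by rewrite inE uH.
have sC := subsetP (comp_sub e uWH).
set C := component e (V :\ y :\: (S :|: A)) u in sC.
have AN t : t \in A -> t \in N x.
  case/common_nbP; rewrite !in_setD1 in_nb => /and3P[_ _ ->] /(_ x xS) -> //.
have CI v : v \in C :\ u -> [/\ v \in V, v != y, v \notin S & v \notin A].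
  rewrite in_setD1 => /andP[_ /sC]; rewrite in_setD in_setU negb_or in_setD1.
  by case/andP=> /andP[-> ->] /andP[-> ->].
have nbW v : v \in C :\ u -> N v \subset V :\ y.
  move=> vC; have [vV vy vS vA] := CI v vC; apply/subsetP=> w.
  rewrite in_nb in_setD1 => /andP[-> evw]; rewrite andbT;
    apply: contraNneq vA => wy.
  apply: (subsetP sNy); rewrite in_setD1 in_nb vV -wy e_sym evw !andbT.
  by move: vC; rewrite in_setD1 => /andP[].
apply: (@biclique_admissible x y (V :\ y) u S 1) => //.
- exact: subD1set.
- have -> : V :\: (V :\ y) = [set y].
    apply/setP=> z; rewrite !inE; case: eqVneq => [->|_] /=;
      first exact: reduced_y c.
    by rewrite andNb.
  by apply: pathl_edge; rewrite ?in_setU1 ?set11 ?eqxx ?orbT // e_sym.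
- by rewrite !inE eqxx /= andbF.
have uI := inner_mem uV unx uny.
have [v vN] : exists2 v, v \in N u & v \notin y |: S.
  apply/subsetPn/negP=> /subset_leq_card; rewrite leqNgt => /negP[].
  apply: leq_trans (reduced_deg c uI uX); rewrite ltnS cardsU1.
  by apply: leq_trans Sk; rewrite -add1n leq_add2r; case: (_ \notin _).
rewrite in_setU1 negb_or => /andP[vy vS].
have [vV euv] : v \in V /\ e u v by apply/andP; move: vN; rewrite in_nb.
have uv := adj_neq e_irr euv.
have vA : v \notin A.
  by apply: contraNN tx => /AN vx; apply: in_triangleI ux vx euv.
have vC : v \in C.
  apply: (comp_closed uWH (comp_refl _ _ _) _ euv).
  by rewrite in_setD in_setU negb_or vS vA in_setD1 vy.
apply/negP=> CX; have vX : v \in X by apply: (subsetP CX);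
  rewrite in_setD1 eq_sym uv.
have [XE k2] := X_single vX; have kE : k = 2 by apply/eqP; rewrite eqn_leq k2.
have Sx : S = [set x].
  apply/esym/eqP; rewrite eqEcard sub1set xS cards1.
  by case: S1k => [->|] //; rewrite kE.
have vx : v != x by apply: contraNneq vS => ->.
case/negP: (nc4 k2); apply/exists_inP; exists v; first exact: inner_mem.
have /leq_trans-> // := deg2 c (inner_mem vV vx vy).
apply/subset_leq_card/subsetP=> w wN; rewrite in_setI wN /=.
have vCu : v \in C :\ u by rewrite in_setD1 eq_sym uv.
have wW := subsetP (nbW v vCu) w wN; move: (wN); rewrite in_nb => /andP[wV evw].
have [-> // | wu] := eqVneq w u.
have [wA | wA] := boolP (w \in A); first exact: AN.
have [wS | wS] := boolP (w \in S).
  move: wS; rewrite Sx in_set1 => /eqP wx; case/negP: vA; apply/common_nbP;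
    split.
    by rewrite !in_setD1 vy eq_sym uv.
  by move=> t; rewrite Sx in_set1 => /eqP->; rewrite -wx e_sym.
have wC : w \in C.
  by apply: (comp_closed uWH vC _ evw); rewrite in_setD in_setU negb_or wS wA.
have : w \in X by apply: (subsetP CX); rewrite in_setD1 wu.
by rewrite XE in_set1 => /eqP wv; rewrite wv e_irr in evw.
Qed.

(** If all neighbours of [y] are in the biclique, they are in one class, as [y] is in no triangle.
    If this is the class of [x], the biclique grown from [y] misses a neighbour of [x]. If it is the
    other class for every choice, a neighbour [u] of [y] becomes the root, provided that taking [u]
    out keeps the classes balanced. *)
Lemma triangle_free_admissible x y : reduced x y -> ~~ in_triangle x ->
  ~~ in_triangle y -> ~~ diamond x -> ~~ diamond y ->
  (k <= 2 -> ~~ in_square x y) -> (k <= 2 -> ~~ in_square y x) ->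
    admissible x y.
Proof.
move=> c tx ty dx dy nx ny; have c' := reduced_sym e_sym c.
have xAF S z : x \in S -> z \in common_nb (V :\ y) S -> z \in N x.
  by move=> xS /common_nbP[]; rewrite in_setD1 in_nb => /andP[_ ->] /(_ x xS).
have [/existsP[S /andP[mS /subsetPn[b bN bA]]] | univ] :=
  boolP [exists S : {set T}, maxstem x y S &&
    ~~ (N y \subset common_nb (V :\ y) S)].
  have [stS maxS] := maxstemP mS; case/and3P: (stS) => xS sS leST.
  have [sub | /subsetPn[b' b'N b'H]] :=
    boolP (N y \subset S :|: common_nb (V :\ y) S); last first.
    exact: maxstem_admissible c tx dx nx mS b'N b'H.
  have bS : b \in S by have := subsetP sub b bN;
    rewrite in_setU (negPf bA) orbF.
  have sNS : N y \subset S.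
    apply/subsetP=> z zN; have := subsetP sub z zN;
      rewrite in_setU => /orP[// | zA].
    by case/negP: ty; apply: in_triangleI bN zN _; case/common_nbP: zA => _;
      apply.
  have [S' mS'] := maxstem_exists c'; have [stS' _] := maxstemP mS'.
  case/and3P: (stS') => yS' sS' leST'.
  (* The common neighbours of [S'] are neighbours of [y], so they lie in [S]. This makes [S'] too
     small to contain [common_nb (V :\ y) S], which consists of neighbours of [x]. *)
  have sT' : common_nb (V :\ x) S' \subset S :\ x.
    apply/subsetP=> z /common_nbP[];
      rewrite in_setD1 => /andP[zx zV] /(_ y yS') eyz.
    by rewrite in_setD1 zx (subsetP sNS) // in_nb zV.
  have xy := reduced_neq c.
  have sTN : common_nb (V :\ y) S \subset N x by apply/subsetP=> z; apply: xAF.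
  have lt : #|S' :\ y| < #|common_nb (V :\ y) S|.
    apply: leq_trans leST; apply: leq_trans (subset_leq_card (subD1set S x)).
    apply: leq_trans (leq_trans leST' (subset_leq_card sT')).
    by rewrite [X in _ < X](cardsD1 y) yS'.
  have [t tT tS'] : exists2 t, t \in common_nb (V :\ y) S & t \notin S' :\ y.
    by apply/subsetPn; apply/negP=> /subset_leq_card; rewrite leqNgt lt.
  have tN := subsetP sTN t tT; have [tV etx _ ty'] := nby_neq e_sym e_irr c' tN.
  apply: admissible_paths_sym => //;
    apply: (maxstem_admissible c' ty dy ny mS' tN).
  rewrite in_setU negb_or; apply/andP; split.
    by move: tS'; rewrite in_setD1; case/common_nbP: tT;
      rewrite in_setD1 => /andP[-> _].
  apply/negP=> /(subsetP sT'); rewrite in_setD1 => /andP[_ tS].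
  by case/common_nbP: tT => _ /(_ t tS); rewrite e_irr.
have {}univ S : maxstem x y S -> N y \subset common_nb (V :\ y) S.
  by move=> mS; move/existsPn: univ => /(_ S); rewrite mS negbK.
have [u uN uX] : exists2 u, u \in N y & u \notin X.
  have [b bN] := neighbour_exists c'; have [bX | bX] := boolP (b \in X);
    last by exists b.
  have [bV _ bx bny] := nby_neq e_sym e_irr c bN.
  have [u uN ub] := neighbour_neq_exceptional c bX (inner_mem bV bx bny).
  exists u; rewrite //; have [-> _] := X_single bX; rewrite in_set1; exact: ub.
have [uV eyu unx uny] := nby_neq e_sym e_irr c uN.
have [S mS] := maxstem_exists c; have [stS maxS] := maxstemP mS.
case/and3P: (stS) => xS sS leST; have uA := subsetP (univ S mS) u uN.
have ux := xAF S u xS uA.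
have notuS S' : maxstem x y S' -> u \notin S'.
  move=> mS'; apply/negP=> uS'; have := subsetP (univ S' mS') u uN.
  by case/common_nbP=> _ /(_ u uS'); rewrite e_irr.
have AuE S' : common_nb (V :\ y :\ u) S' = common_nb (V :\ y) S' :\ u.
  by apply/setP=> z; rewrite !inE -!andbA.
have yAF S' : y \notin common_nb (V :\ y) S' by apply/negP=> /common_nbP[];
  rewrite !inE eqxx.
have [kS | Sk] := leqP k #|S|.
  (* A class of at least [k] vertices already has [k] odd paths from [x] to [u], and the edge from
     [u] to [y] completes them. *)
  exists 2, 2; split=> [|i i_lt]; first by right.
  split; first by rewrite leq_addr.
  have iS : i < #|S| by apply: leq_trans kS.
  have p : pathl e (S :|: common_nb (V :\ y) S) x u i.*2.+1.
    apply: biclique_path_odd => //;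
      first by move=> a t aS /common_nbP[_ /(_ a aS)].
      exact: common_nb_disj.
    exact: leq_trans leST.
  have yH : y \notin S :|: common_nb (V :\ y) S.
    by rewrite in_setU negb_or yAF andbT; apply/negP=> /(subsetP sS);
      rewrite !inE eqxx.
  rewrite add2n mul2n; apply: pathl_rev => //.
  apply: (pathl_sub _ (pathl_cons eyu yH (pathl_rev e_sym p))).
  rewrite !subUset sub1set (reduced_y c) (subset_trans sS (subD1set _ _)) /=.
  by apply/subsetP=> z /common_nbP[]; rewrite in_setD1 => /andP[].
have S1k S' : stem x y S' -> #|S'| = 1 \/ 2 < k.
  by move=> st; case: (leqP k 2) => k2; [left;
    apply: stem1 c k2 (nx k2) st | right].
have sNyu S' : N y \subset common_nb (V :\ y) S' ->
  N y :\ u \subset common_nb (V :\ y :\ u) S'.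
  by move=> sub; rewrite AuE; apply: setSD.
have [/existsP[S' /andP[mS' ltS']] | none] :=
  boolP [exists S' : {set T}, maxstem x y S' &&
    (#|S'| < #|common_nb (V :\ y) S'|)].
  (* The other class has a vertex to spare, so it stays large enough without [u]. *)
  have [stS' maxS'] := maxstemP mS'; case/and3P: (stS') => xS' sS' leST'.
  apply: (reroot_admissible (u := u) (S := S') c) => //.
  - by rewrite subsetD1 sS' notuS.
  - rewrite AuE; have := subsetP (univ S' mS') u uN => uA'.
    by move: ltS'; rewrite (cardsD1 u (common_nb _ _)) uA' add1n ltnS.
  - move=> v; rewrite in_setD1 => /andP[vu vW] vS'; rewrite leqNgt;
    apply/negP=> lt1.
    have : stem x y (v |: S').
      rewrite /stem in_setU1 xS' orbT subUset sub1set vW sS' /= cardsU1 vS'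
        add1n.
      apply: leq_trans lt1 (subset_leq_card _);
        exact: common_nbS (subD1set _ _) (subxx _).
    by move/maxS'; rewrite cardsU1 vS' ltnn.
  - exact: sNyu (univ S' mS').
  - by apply: leq_ltn_trans Sk; apply: maxS.
  exact: S1k.
have {}none S' : maxstem x y S' -> #|common_nb (V :\ y) S'| <= #|S'|.
  by move=> mS'; move/existsPn: none => /(_ S'); rewrite mS' /= -leqNgt.
have [S1 | S2] := leqP #|S| 1.
  (* Now the other class is never larger. With one vertex in each class, [u] is the only neighbour
     of both roots and would be a cut vertex. *)
  have Sx : S = [set x] by apply/esym/eqP; rewrite eqEcard sub1set xS cards1.
  have AE : common_nb (V :\ y) S = [set u].
    apply/esym/eqP; rewrite eqEcard sub1set uA cards1.
    exact: leq_trans (none S mS) S1.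
  have Nx z : z \in N x -> z = u.
    move=> zN; have [zV exz zy zx] := nby_neq e_sym e_irr c' zN.
    apply/set1P; rewrite -AE; apply/common_nbP; rewrite in_setD1 zy zV;
      split=> //.
    by move=> t; rewrite Sx in_set1 => /eqP->.
  have Ny z : z \in N y -> z = u.
    by move/(subsetP (univ S mS)); rewrite AE in_set1 => /eqP.
  have [D0 | D0] := boolP (V :\: [set x; y] :\ u == set0).
    have : #|N u| <= #|[set x; y]|.
      apply/subset_leq_card/subsetP=> z; rewrite in_nb => /andP[zV euz].
      apply: contraTT euz => zxy; have : z \notin V :\: [set x;
        y] :\ u by rewrite (eqP D0) inE.
      by rewrite in_setD1 in_setD zxy zV !andbT negbK => /eqP->; rewrite e_irr.
    move/leq_trans/(_ (card2_le _ _)) => le2.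
    have := reduced_deg c (inner_mem uV unx uny) uX.
    by rewrite ltnNge (leq_trans le2 k_gt1).
  suff : 1 < #|[set u]| by rewrite cards1.
  apply: leq_trans (reduced_rooted c D0 (subD1set _ _)) _.
  apply/subset_leq_card/subsetP=> w /bdP[wV wD [v vD evw]]; rewrite in_set1.
  move: vD; rewrite in_setD1 => /andP[vu]; rewrite in_setD => /andP[_ vV].
  apply: contraNT vu => wu; move: wD;
    rewrite in_setD1 wu in_setD wV andbT negbK in_set2.
  case/orP=> /eqP wE; subst w; apply/eqP.
    by apply: Nx; rewrite in_nb vV e_sym.
  by apply: Ny; rewrite in_nb vV e_sym.
(* The balance is kept by taking out [p] together with [u]. A vertex [v] violating the bound for
   [S :\ p] would make [v |: S :\ p] a maximum stem with [u] as a spare common neighbour, which is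
   excluded. *)
have /card_gt0P[p] : 0 < #|S :\ x| by move: S2; rewrite (cardsD1 x S) xS.
rewrite in_setD1 => /andP[px pS].
have cS : #|S| = #|S :\ p|.+1 by rewrite [LHS](cardsD1 p) pS.
have sA : common_nb (V :\ y) S \subset common_nb (V :\ y) (S :\ p) :=
  common_nbS (subxx _) (subD1set _ _).
apply: (reroot_admissible (u := u) (S := S :\ p) c) => //.
- by rewrite in_setD1 eq_sym px.
- by rewrite subsetD1 (subset_trans (subD1set _ _) sS) in_setD1 (negPf (notuS S
  mS)) andbF.
- rewrite AuE -ltnS -cS;
  apply: leq_trans leST (leq_trans (subset_leq_card sA) _).
  by rewrite (cardsD1 u) -add1n leq_add2r; case: (_ \in _).
- move=> v; rewrite in_setD1 => /andP[vu vW] vS; rewrite leqNgt;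
  apply/negP=> lt1.
  set S' := v |: S :\ p in lt1;
    have cS' : #|S'| = #|S| by rewrite cardsU1 vS cS.
  have sA' : common_nb (V :\ y :\ u) S' \subset common_nb (V :\ y) S' :=
    common_nbS (subD1set _ _) (subxx _).
  have stS' : stem x y S'.
    rewrite /stem in_setU1 in_setD1 eq_sym [x == p]eq_sym px xS orbT /= subUset
      sub1set vW.
    rewrite (subset_trans (subD1set _ _) sS) cS' cS /=.
    exact: leq_trans lt1 (subset_leq_card sA').
  have mS' : maxstem x y S'.
    by rewrite /maxstem stS'; apply/forallP=> S0; apply/implyP=> /maxS;
      rewrite cS'.
  have := none S' mS'; rewrite leqNgt cS' cS => /negP[].
  apply: leq_ltn_trans lt1 _; rewrite AuE.
  by rewrite [X in _ < X](cardsD1 u) (subsetP (univ S' mS') u uN).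
- exact: sNyu (subset_trans (univ S mS) sA).
- by apply: ltnW; rewrite -cS.
by right; apply: leq_trans Sk.
Qed.

End TriangleFree.

(** * The induction *)

Section Main.
Variable T : finType.
Implicit Types (e : rel T) (V X D : {set T}) (x y : T).

(** The path is led through an inner vertex, so its length is at least 2. *)
Lemma one_path e V x y X : rooted_graph e V x y 1 X ->
  admissible_paths e V x y 1.
Proof.
move=> [e_sym e_irr xV yV xy Vxy _ inn _].
have [v vI] : exists v, v \in V :\: [set x; y].
  by apply/set0Pn; apply: contraNneq inn => ->; rewrite sub0set.
have I0 : V :\: [set x; y] != set0 by apply/set0Pn; exists v.
move: vI; rewrite in_setD in_set2 negb_or => /andP[/andP[vx vy] vV].
have [A [B [m [n [sA sB AB pA pB]]]]] := crossed_all e_sym xV yV Vxy I0 vV.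
apply: (@progression1 _ (m + n)); split; last first.
  by apply: pathl_sub (pathl_cat AB pA pB); rewrite subUset sA.
case: m pA => [/pathl_inv0 xv | m _]; first by rewrite xv eqxx in vx.
case: n pB => [/pathl_inv0 vy' | n _]; first by rewrite vy' eqxx in vy.
by rewrite addSn addnS.
Qed.

(** Rooted at its two boundary vertices, [D] is a smaller instance in which inner vertices keep
    their degrees. Two disjoint paths from the roots to this boundary lengthen all its paths
    equally. *)
Lemma two_separation e V x y k X D :
    (forall e' (V' : {set T}) x' y' k' X', #|V'| < #|V| ->
       rooted_graph e' V' x' y' k' X' -> admissible_paths e' V' x' y' k') ->
    rooted_graph e V x y k X -> D != set0 -> D \subset V :\: [set x; y] ->
    ~~ (V :\: [set x; y] \subset D) -> ~~ (D \subset X) -> #|bd e V D| <= 2 ->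
  admissible_paths e V x y k.
Proof.
move=> IH [e_sym e_irr xV yV xy Vxy cX inn dg] D0 sD nD DX le2.
have I0 : V :\: [set x; y] != set0.
  by apply: contraNneq inn => ->; rewrite sub0set.
have [A [B [c [d [m [n [sA sB dAB [cb db cd] [pA pB]]]]]]]] :=
  link e_sym xV yV Vxy I0 D0 sD.
have bdE : bd e V D = [set c; d].
  by apply/esym/eqP; rewrite eqEcard subUset !sub1set cb db cards2 cd.
have [cV cD _] := elimT (bdP _ _ _ _) cb;
  have [dV dD _] := elimT (bdP _ _ _ _) db.
set V1 := D :|: [set c; d].
have sDV : D \subset V := subset_trans sD (subsetDl _ _).
have sV1 : V1 \subset V by rewrite !subUset !sub1set sDV cV.
have V1lt : #|V1| < #|V|.
  apply: proper_card; rewrite properE sV1; apply/negP=> sVV1.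
  have cdI z : z \in V -> z \notin D -> z \in [set c; d].
    by move=> zV zD; case/setUP: (subsetP sVV1 z zV); rewrite // (negPf zD).
  case/subsetPn: nD => z zI zD; move: (zI); rewrite in_setD in_set2 negb_or.
  case/andP=> /andP[zx zy] zV.
  have notD r : r \in [set x; y] -> r \notin D.
    by move=> rxy; apply/negP=> /(subsetP sD); rewrite in_setD rxy.
  have : #|[set x; y; z]| <= #|[set c; d]|.
    apply/subset_leq_card; rewrite !subUset !sub1set.
    by rewrite (cdI x xV (notD x (set21 _ _))) (cdI y yV (notD y (set22 _ _)))
      (cdI z zV zD).
  rewrite cards2 cd setUC cardsU1 cards2 xy in_set2 negb_or zx zy //.
have V1D : V1 :\: [set c; d] = D.
  apply/setP=> z; rewrite in_setD [z \in V1]in_setU;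
    case: (boolP (z \in D)) => zD /=.
    by rewrite andbT in_set2 negb_or; apply/andP; split;
      apply: contraTneq zD => ->.
  by rewrite andNb.
have nbV1 v w : v \in D -> w \in V -> e v w -> w \in V1.
  move=> vD wV evw; rewrite in_setU; case: (boolP (w \in D)) => //= wD.
  by rewrite -bdE; apply/bdP; split=> //; exists v.
have RG : rooted_graph e V1 c d k X.
  split; rewrite ?V1D //.
  - by apply/setUP; right; apply: set21.
  - by apply/setUP; right; apply: set22.
  - move=> D' D'0; rewrite V1D => sD'.
    apply: leq_trans (Vxy D' D'0 (subset_trans sD' sD)) _.
    apply/subset_leq_card/subsetP=> w /bdP[wV wD' [v vD' evw]].
    by apply/bdP; split=> //;
      [apply: nbV1 (subsetP sD' v vD') wV evw | exists v].
  move=> v vD vX k1; apply: leq_trans (dg v (subsetP sD v vD) vX k1) _.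
  apply/subset_leq_card/subsetP=> w; rewrite !in_nb => /andP[wV evw].
  by rewrite evw (nbV1 v w).
rewrite /admissible_paths;
  apply: (progression_shift (m := m + n)) (IH _ _ _ _ _ _ V1lt RG) => i [i2 pi].
split; first by rewrite (leq_trans i2) ?leq_addr.
have AD z : z \in A -> z \in V1 -> z = c.
  move=> zA /setUP[zD | /set2P[// | zd]].
    by have := subsetP sA z zA; rewrite in_setD zD.
  by have [dB _] := pathl_ends pB; rewrite -zd (disjointFr dAB zA) in dB.
have BD z : z \in A :|: V1 -> z \in B -> z = d.
  move=> /setUP[zA | zV1] zB; first by rewrite (disjointFr dAB zA) in zB.
  case/setUP: zV1 => [zD | /set2P[zc | //]].
    by have := subsetP sB z zB; rewrite in_setD zD.
  by have [_ cA] := pathl_ends pA; rewrite -zc (disjointFl dAB zB) in cA.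
have := pathl_cat BD (pathl_cat AD pA pi) pB.
rewrite [m + i]addnC -addnA; apply: pathl_sub.
by rewrite !subUset (subset_trans sA (subsetDl _ _)) (subset_trans sB (subsetDl
  _ _)) sDV !sub1set cV dV.
Qed.

Lemma reduced_admissible e V x y k X :
    (forall e' (V' : {set T}) x' y' k' X', #|V'| < #|V| ->
       rooted_graph e' V' x' y' k' X' -> admissible_paths e' V' x' y' k') ->
    symmetric e -> irreflexive e -> 1 < k -> #|X| <= (k <= 2) ->
    reduced e V X k x y -> admissible_paths e V x y k.
Proof.
move=> IH e_sym e_irr k1 cX c; have c' := reduced_sym e_sym c.
have finish : ~~ in_triangle e V x -> ~~ in_triangle e V y ->
  ~~ diamond e V x -> ~~ diamond e V y ->
    (k <= 2 -> ~~ in_square e V x y) -> (k <= 2 -> ~~ in_square e V y x) ->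
      admissible_paths e V x y k.
  exact: (triangle_free_admissible e_sym e_irr IH k1 cX).
have [k2 | k2] := leqP k 2.
  have kE : k = 2 by apply/eqP; rewrite eqn_leq k2.
  have [tx | tx] := boolP (in_triangle e V x);
    first exact: (two_paths_triangle e_sym e_irr c).
  have [ty | ty] := boolP (in_triangle e V y).
    by apply: admissible_paths_sym => //;
      apply: (two_paths_triangle e_sym e_irr c').
  have [nx | nx] := boolP (in_square e V x y);
    first exact: (two_paths_square e_sym e_irr cX c).
  have [ny | ny] := boolP (in_square e V y x).
    by apply: admissible_paths_sym => //;
      apply: (two_paths_square e_sym e_irr cX c').
  (* A diamond contains a 4-cycle in which [p] is opposite to [u]; as [p] lies in a triangle, it is
     not a root. *)
  have dc4 u v : reduced e V X k u v -> ~~ in_triangle e V u ->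
    ~~ in_triangle e V v -> ~~ in_square e V u v ->
      ~~ diamond e V u.
    move=> cu tu tv nu; apply: contra nu =>
      /exists_inP[w1 w1u /exists_inP[w2 w2u /andP[w12]]].
    case/exists_inP=> p; rewrite in_setI !in_nb =>
      /andP[/andP[pV e1p] /andP[_ e2p]].
    case/exists_inP=> q; rewrite in_setI !in_nb =>
      /andP[/andP[qV e1q] /andP[_ e2q]] epq.
    have w1V : w1 \in V by move: w1u; rewrite in_nb => /andP[].
    have np z : ~~ in_triangle e V z -> p != z.
      move=> tz; apply: contraNneq tz => pz; subst z.
      by apply: (in_triangleI (a := w1) (b := q));
        rewrite ?in_nb ?w1V ?qV // e_sym.
    apply/exists_inP; exists p; first by apply: inner_mem => //; apply: np.
    apply/card_gt1P; exists w1, w2; split=> //;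
      rewrite in_setI ?w1u ?w2u andbT in_nb e_sym.
      by rewrite w1V.
    by rewrite e2p andbT; move: w2u; rewrite in_nb => /andP[].
  by apply: finish => //; [apply: dc4 c tx ty nx | apply: dc4 c' ty tx ny].
have [tx | tx] := boolP (in_triangle e V x);
  first exact: (triangle_admissible e_sym e_irr IH k1 cX c).
have [ty | ty] := boolP (in_triangle e V y).
  by apply: admissible_paths_sym => //;
    apply: (triangle_admissible e_sym e_irr IH k1 cX c').
have [dx | dx] := boolP (diamond e V x);
  first exact: (diamond_admissible e_sym e_irr IH k1 cX c).
have [dy | dy] := boolP (diamond e V y).
  by apply: admissible_paths_sym => //;
    apply: (diamond_admissible e_sym e_irr IH k1 cX c').
by apply: finish => //; rewrite leqNgt k2.
Qed.

Theorem rooted_paths e V x y k X : rooted_graph e V x y k X ->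
  admissible_paths e V x y k.
Proof.
have [n] := ubnP #|V|; elim: n e V x y k X => // n IHn e V x y k X Vn RG.
case: k RG => [|[|k]] RG; [exact: progression0 | exact: one_path RG |].
have IH e' (V' : {set T}) x' y' k' X' : #|V'| < #|V| ->
    rooted_graph e' V' x' y' k' X' -> admissible_paths e' V' x' y' k'.
  by move=> ltV; apply: IHn; apply: leq_trans ltV _.
(* Deleting an edge between the roots makes them non-adjacent, and it changes neither the neighbours
   of inner vertices nor the boundaries of sets of inner vertices. *)
pose e0 a b := e a b && ~~ ((a \in [set x; y]) && (b \in [set x; y])).
have e0e a b : e0 a b -> e a b by case/andP.
have e0I a b : a \in V :\: [set x; y] -> e0 a b = e a b.
  by rewrite in_setD /e0 => /andP[/negPf-> _]; rewrite andbT.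
have bd0 D : D \subset V :\: [set x; y] -> bd e0 V D = bd e V D.
  move=> sD; apply/setP=> w; apply/bdP/bdP=> [] [wV wD [v vD evw]];
    split=> //; exists v => //.
    exact: e0e.
  by rewrite e0I // (subsetP sD).
have nb0 v : v \in V :\: [set x; y] -> nb e0 V v = nb e V v.
  by move=> vI; apply/setP=> w; rewrite !in_nb e0I.
case: (RG) => e_sym e_irr xV yV xy Vxy cX inn dg.
have e0_sym : symmetric e0.
  by move=> a b; rewrite /e0 e_sym [(b \in _) && _]andbC.
have e0_irr : irreflexive e0 by move=> a; rewrite /e0 e_irr.
have RG0 : rooted_graph e0 V x y k.+2 X.
  split=> //; first by move=> D D0 sD; rewrite bd0 // Vxy.
  by move=> v vI; rewrite nb0 //; apply: dg.
suff : admissible_paths e0 V x y k.+2.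
  apply: progression_imply => m [m2 p]; split=> //.
  by apply: pathl_rel p => a b _ _; apply: e0e.
have [/existsP[D /and5P[D0 sD nD DX le2]] | none] := boolP [exists D : {set T},
  [&& D != set0, D \subset V :\: [set x; y], ~~ (V :\: [set x; y] \subset D),
   ~~ (D \subset X) & #|bd e0 V D| <= 2]].
  exact: two_separation IH RG0 D0 sD nD DX le2.
apply: (@reduced_admissible e0 V x y k.+2 X IH e0_sym e0_irr isT cX);
  split=> //.
- by rewrite /e0 set21 set22 andbF.
- exact: (rg_rooted RG0).
- move=> D D0 sD nD DX; rewrite ltnNge; apply: contra none => le2.
  by apply/existsP; exists D; apply/and5P.
by move=> v vI vX; apply: (rg_deg RG0).
Qed.

End Main.

(** * From paths between adjacent vertices to cycles *)

Section Cycles.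
Variable G : sgraph.
Implicit Types (x y v : G) (D : {set G}).

Lemma min_degree_le x : min_degree G <= degree x.
Proof.
rewrite /min_degree; have := mem_index_enum x.
elim: (index_enum G) => // y s IHs; rewrite inE big_cons geq_min.
by case/orP=> [/eqP-> | /IHs->]; rewrite ?leqnn ?orbT.
Qed.

(** Deleting a boundary of at most one vertex leaves one of the roots in place, and this root would
    be separated from [D]. *)
Lemma k_connected_rooted x y : k_connected G 2 -> x != y ->
  rooted (@adj G) [set: G] x y.
Proof.
move=> [_ conG] xy D /set0Pn[v vD] sD; rewrite ltnNge; apply/negP=> le1.
set S := bd _ _ D in le1.
have [r rxy rS] : exists2 r, r \in [set x; y] & r \notin S.
  apply/subsetPn/negP=> /subset_leq_card; rewrite cards2 xy => le2.
  by have := leq_trans le2 le1.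
have rD : r \notin D by apply/negP=> /(subsetP sD); rewrite in_setD rxy.
have vS : v \notin S by apply/negP=> /bdP[]; rewrite vD.
have closedD : closed (adj_minus S) (mem D).
  have clD a b : adj_minus S a b -> a \in D -> b \in D.
    case/and3P=> ab _ bS aD; apply: contraNT bS => bD.
    by apply/bdP; rewrite in_setT; split=> //; exists a.
  move=> a b ab; apply/idP/idP; first exact: clD.
  by apply: clD; move: ab;
    rewrite /adj_minus /= adj_sym [(b \notin S) && _]andbC.
have := closed_connect closedD (conG S le1 v r vS rS).
by rewrite /= vD (negPf rD).
Qed.

Lemma path_cycle x y n : adj x y -> 2 <= n -> pathl (@adj G) setT x y n ->
  exists2 c : seq G, is_cycle c & size c = n.+1.
Proof.
move=> xy n2 [p /and5P[ep /eqP lp Up _ /eqP sp]]; exists (x :: p);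
  last by rewrite /= sp.
apply/and3P; split=> //; first by rewrite /= sp.
by rewrite /= rcons_path ep lp adj_sym.
Qed.

Lemma progression_cycles k : 0 < k ->
  progression k (fun n => exists2 c : seq G, is_cycle c & size c = n) ->
  exists H : seq (seq G),
    [/\ size H = k,
        forall c : seq G, c \in H -> is_cycle c
      & consecutive_lengths H \/ length_condition H].
Proof.
move=> k0 [a [d [d12 cyc]]].
have [H [sH HP]] : exists H : seq (seq G), size H = k /\
    forall i, i < k -> is_cycle (nth [::] H i) /\ size (nth [::] H i) = a + d *
      i.
  elim: (k) cyc => [|j IHj] cyc; first by exists [::].
  have [i lt_ij|H [sH HP]] := IHj; first by apply: cyc; apply: ltnW.
  have [c cc sc] := cyc j (ltnSn j).
  exists (rcons H c); rewrite size_rcons sH; split=> // i;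
    rewrite ltnS leq_eqVlt nth_rcons sH.
  by case/orP=> [/eqP-> | lt_ij]; [rewrite ltnn eqxx | rewrite lt_ij;
    apply: HP].
have card_nth i : i < k -> #|cycle_edges (nth [::] H i)| = a + d * i.
  by move=> /HP[ci <-]; apply: card_cycle_edges.
have steps : lengths_step d H.
  split.
    have [c0 _] := HP 0 k0; rewrite -nth0 card_cycle_edges //.
    by case/and3P: c0 => /ltnW.
  apply/(sortedP [::]) => i; rewrite sH => lt_ik.
  by rewrite !card_nth // ?(ltnW lt_ik) // mulnS [d + _]addnC addnA eqxx.
exists H; split=> //; last by case: d12 steps {cyc HP card_nth} => -> st;
  [left | right].
move=> c cH; have lt_i : index c H < k by rewrite -sH index_mem.
by rewrite -(nth_index [::] cH); case: (HP _ lt_i).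
Qed.

End Cycles.

Theorem theorem6 (k : nat) (G : sgraph) (k_gt0 : 0 < k)
    (G_3conn : k_connected G 3) (G_nonbip : ~ bipartite G)
    (G_mindeg : k + 1 <= min_degree G) :
  exists H : seq (seq G),
    [/\ size H = k,
        forall c : seq G, c \in H -> is_cycle c
      & consecutive_lengths H \/ length_condition H].
Proof.
have [cG conG] := G_3conn.
have degG (v : G) : k < #|nb (@adj G) setT v|.
  rewrite -addn1; apply: leq_trans G_mindeg (leq_trans (min_degree_le v) _).
  by apply/subset_leq_card/subsetP=> w; rewrite !inE.
have /card_gt0P[x _] : 0 < #|G| by apply: leq_trans cG.
have /card_gt0P[y] : 0 < #|nb (@adj G) setT x| by apply: leq_trans (degG x).
rewrite in_nb in_setT /= => xy.
have neq_xy : x != y by apply: contraTneq xy => ->; rewrite adj_irrefl.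
have RG : rooted_graph (@adj G) setT x y k set0.
  split; rewrite ?cards0 //; [exact: adj_sym | exact: adj_irrefl | |].
    apply: k_connected_rooted neq_xy; split=> [|S S2]; first exact: ltnW.
    exact/conG/ltnW.
  rewrite subset0; apply: contraTneq cG => D0; rewrite -leqNgt -cardsT.
  apply: leq_trans (subset_leq_card (B := [set x; y]) _) _;
    last by rewrite cards2; case: (_ != _).
  by rewrite -setD_eq0 D0.
apply: progression_cycles k_gt0 _.
(* The shift by 1 counts the edge [xy] that closes each path. *)
apply: (progression_shift (m := 1)) (rooted_paths RG) => n [n2 p].
by rewrite addn1; apply: path_cycle xy n2 p.
Qed.
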